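(* Let $G$ be a biconnected series-parallel graph without transitive edges. The following are equivalent: (1) every separation pair of $G$ has at most two heavy components (i.e., $G$ is at most 2-heavy); (2) $G$ admits a grounded string representation (i.e., $G$ is outerstring); (3) $G$ admits a grounded L-$\Gamma$-mirror representation, i.e., a grounded string representation in which every curve is an orthogonal polyline with at most one bend, the bend (if any) being a bottommost point of the curve.
   Context: A grounded string representation of a graph $G$: there is a horizontal line $\ell$; each vertex $v$ is represented by a simple curve lying below $\ell$ with exactly one endpoint (its anchor) on $\ell$, and two curves intersect if and only if the corresponding vertices are adjacent. In (3), each curve thus consists of a vertical segment from its anchor downward, possibly followed by one horizontal segment going left or right (an ''L'' or a mirrored ''L''). A biconnected graph is series-parallel if it contains no subdivision of $K_4$. A separation pair of a biconnected graph $G$ is a pair $(s,t)$ of vertices with $G-s-t$ disconnected; a transitive edge is an edge joining the two vertices of a separation pair. A component w.r.t. $(s,t)$ is the subgraph induced by $s$, $t$ and the vertex set of one connected component of $G-s-t$; vertices other than $s,t$ are internal. A component is heavy if it has an internal vertex adjacent to neither $s$ nor $t$, and light otherwise. $G$ is at most 2-heavy if every separation pair has at most two heavy components. *)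

(* Defs.v *)
From HB Require Import structures.
From mathcomp Require Import all_boot all_order all_algebra.
From mathcomp Require Import all_classical all_reals topology normedtype.
From mathcomp Require Import Rstruct Rstruct_topology.

Set Implicit Arguments.
Unset Strict Implicit.
Unset Printing Implicit Defensive.

Import Order.TTheory GRing.Theory Num.Theory numFieldNormedType.Exports.

(* Graph-theoretic notions.  A finite simple graph is a symmetric,     *)
(* irreflexive relation e on a finite type T of vertices.              *)
Section Graphs.
Variables (T : finType) (e : rel T).

Definition restr (S : {set T}) : rel T :=
  fun x y => [&& x \notin S, y \notin S & e x y].

Definition connected_minus (S : {set T}) : Prop :=
  forall x y, x \notin S -> y \notin S -> connect (restr S) x y.

Definition biconnected : Prop :=
  [/\ 3 <= #|T|, connected_minus finset.set0 & forall v, connected_minus [set v]].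

Definition gpath (x : T) (p : seq T) (y : T) : bool :=
  [&& path e x p, last x p == y & uniq (x :: p)].

Definition interior (p : seq T) (y : T) : pred T :=
  fun v => (v \in p) && (v != y).

Definition has_K4_subdivision : Prop :=
  exists (b : 'I_4 -> T) (P : 'I_4 -> 'I_4 -> seq T),
    [/\ injective b,
        (forall i j : 'I_4, i < j -> gpath (b i) (P i j) (b j)),
        (forall (i j k : 'I_4) v, i < j -> v \in interior (P i j) (b j) ->
            v != b k) &
        (forall (i j i' j' : 'I_4) v, i < j -> i' < j' -> (i, j) != (i', j') ->
            v \in interior (P i j) (b j) -> v \notin interior (P i' j') (b j'))].

Definition series_parallel : Prop := biconnected /\ ~ has_K4_subdivision.

Definition separation_pair (s t : T) : Prop :=
  s != t /\ ~ connected_minus [set s; t].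

Definition no_transitive_edges : Prop :=
  forall s t, e s t -> ~ separation_pair s t.

Definition comp (S : {set T}) (x : T) : {set T} :=
  [set y | connect (restr S) x y].

(* the heavy components w.r.t. (s,t), each represented by its set of
   internal vertices: components having an internal vertex adjacent to
   neither s nor t *)
Definition heavy_components (s t : T) : {set {set T}} :=
  [set comp [set s; t] x |
     x in [set x | [&& x \notin [set s; t], ~~ e s x & ~~ e t x]]].

Definition at_most_2_heavy : Prop :=
  forall s t, separation_pair s t -> #|heavy_components s t| <= 2.

End Graphs.

(* Grounded string representations.  The ground line l is the x-axis   *)
(* {y = 0}; "below l" means y < 0.  A curve is a map g : R -> R * R     *)
(* considered on the parameter interval [0,1]; its anchor is g 0.       *)
Section Reps.
Local Open Scope ring_scope.
Local Open Scope classical_set_scope.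
Variable R : realType.

Definition I01 : set R := [set t | 0 <= t <= 1].

Definition grounded_curve (g : R -> R * R) : Prop :=
  [/\ {within I01, continuous g},
      (forall s t, I01 s -> I01 t -> g s = g t -> s = t),
      (g 0).2 = 0 &
      (forall t, 0 < t <= 1 -> (g t).2 < 0)].

Definition meets (g h : R -> R * R) : Prop :=
  exists s t, [/\ I01 s, I01 t & g s = h t].

Variables (T : finType) (e : rel T).

Definition grounded_string_rep (g : T -> R -> R * R) : Prop :=
  (forall v, grounded_curve (g v)) /\
  (forall u v, u != v -> (meets (g u) (g v) <-> e u v)).

Definition outerstring : Prop := exists g, grounded_string_rep g.

Definition Lshape (a h w : R) : set (R * R) :=
  [set p | (p.1 = a /\ - h <= p.2 <= 0) \/
           (p.2 = - h /\ Num.min a (a + w) <= p.1 <= Num.max a (a + w))].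

Definition grounded_LGamma_mirror_rep (g : T -> R -> R * R) : Prop :=
  grounded_string_rep g /\
  (forall v, exists a h w, 0 < h /\ g v @` I01 = Lshape a h w).

Definition has_LGamma_mirror_rep : Prop :=
  exists g, grounded_LGamma_mirror_rep g.

End Reps.

(* Main.v *)
(** A biconnected series-parallel graph without transitive edges has no cycle
    with a chord: the ends of a chord do not separate the graph, so some path
    joins the two arcs of the cycle and yields a subdivision of K4.

    Outerstring implies 2-heavy.  A heavy component at (s,t) contains an induced
    s-t path through a vertex x adjacent to neither s nor t.  Given three of them,
    two of the anchors x_i, x_j are not separated by the anchors of s and t, so
    that {x_i,t} and {x_j,s} (or {x_j,t} and {x_i,s}) interleave on the ground
    line; the curves along the two corresponding disjoint, mutually nonadjacent
    paths would have to cross.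

    2-heavy implies a drawing.  Let Z be a longest cycle.  Every component of
    G - Z is attached to exactly two vertices of Z (otherwise K4), these pairs do
    not cross (otherwise K4), and every such component is light (otherwise there
    would be three heavy components or a longer cycle).  A light component is
    either one vertex adjacent to both s and t, or a complete bipartite graph
    between neighbours of s and neighbours of t.  Some vertex w of Z is attached
    to no component.  The path z_0, ..., z_(m-1) = Z - w is drawn by vertical
    segments from left to right, z_(i+1) turning left to touch z_i, and the
    components (w being one of them) are drawn by horizontal segments that are
    the deeper the smaller the left end of their pair, and then the larger its
    right end. *)

Require Import Defs.
From HB Require Import structures.
From mathcomp Require Import all_boot zify.

Set Implicit Arguments.
Unset Strict Implicit.
Unset Printing Implicit Defensive.

(* A [Spine] vertex is z_(l u).  The other vertices u lie in components attached to z_(l u) and z_(r u):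
   a [Tie] is adjacent to both, a [LeftArm] to z_(l u) only, a [RightArm] to z_(r u) only.
   [g u] identifies the component of u. *)
Inductive role := Spine | Tie | LeftArm | RightArm.

(** * Layouts: the combinatorial data of a drawing and its integer coordinates *)

Section Layout.
Variable (T : finType).
Variables (ro : T -> role) (l r g : T -> nat).

Definition layout_adj (u v : T) : bool :=
  match ro u, ro v with
  | Spine, Spine => (l u == (l v).+1) || (l v == (l u).+1)
  | Spine, Tie => (l u == l v) || (l u == r v)
  | Tie, Spine => (l v == l u) || (l v == r u)
  | Spine, LeftArm => l u == l v
  | LeftArm, Spine => l v == l u
  | Spine, RightArm => l u == r v
  | RightArm, Spine => l v == r u
  | LeftArm, RightArm | RightArm, LeftArm => g u == g v
  | _, _ => false
  end.

Definition spine u := if ro u is Spine then true else false.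
Definition tie u := if ro u is Tie then true else false.

(** Since [bridge_nc] is required for both orders of [u] and [v], it excludes both ways in which two
    pairs of ends can cross. *)
Record layout_ok (m : nat) : Prop := LayoutOk {
  spine_lt : forall u, spine u -> l u < m;
  spine_inj : forall u v, spine u -> spine v -> l u = l v -> u = v;
  bridge_lt : forall u, ~~ spine u -> l u < r u < m;
  bridge_nc : forall u v, ~~ spine u -> ~~ spine v ->
    l u < r v -> r v < r u -> l u <= l v;
  group_lr : forall u v, ~~ spine u -> ~~ spine v -> g u = g v ->
    l u = l v /\ r u = r v;
  tie_group : forall u v, tie u -> ~~ spine v -> g u = g v -> u = v }.

Variable m : nat.
Hypothesis Hok : layout_ok m.

Let K := #|T|.+1.
Let G := (\max_(u : T) g u).+1.
Let id (u : T) : nat := enum_rank u.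

(* Depths and abscissas are lexicographically ordered tuples, encoded as numbers in mixed radix. *)
Definition depth_key (a b c q : nat) := (((m - a) * m.+1 + b) * G + c) * K.+1 + q.
Definition depth_bound := (depth_key 0 m G.-1 K).+1.
(** The entry [m] exceeds every right end, so z_i is deeper than everything that starts at z_i. The
    last entry [K] exceeds every [id], so the right arms of a component reach below all its left
    arms. *)
Definition depth (u : T) : nat :=
  match ro u with
  | Spine => depth_key (l u) m 0 0
  | LeftArm => depth_key (l u) (r u) (g u) (id u)
  | _ => depth_key (l u) (r u) (g u) K
  end.
Definition abscissa_key (i cls sub q : nat) := ((i * 3 + cls) * depth_bound + sub) * K + q.
(* From left to right: the ties and right arms ending at z_i, the left arms starting at z_i, then z_i. *)
Definition abscissa (u : T) : nat :=
  match ro u with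
  | Spine => abscissa_key (l u) 2 0 0
  | LeftArm => abscissa_key (l u) 1 (depth_bound - (depth u).+1) (id u)
  | _ => abscissa_key (r u) 0 (depth u) (id u)
  end.
(** The range of the horizontal segment: spine vertices and ties turn left, left arms turn right.
    Right arms have a one-point range, and so has z_0 because [0.-1] is [0]. *)
Definition reach_lo (u : T) : nat :=
  match ro u with
  | Spine => abscissa_key (l u).-1 2 0 0
  | Tie => abscissa_key (l u) 2 0 0
  | _ => abscissa u
  end.
(** All right arms of a component share one depth. Ending with [K.-1], which no [id] exceeds, a left
    arm reaches all their verticals but stops before z_(r u). *)
Definition reach_hi (u : T) : nat :=
  match ro u with
  | LeftArm => abscissa_key (r u) 0 (depth_key (l u) (r u) (g u) K) K.-1
  | _ => abscissa u
  end.

Lemma lexle p q N a b : a < N -> b < N ->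
  (p * N + a <= q * N + b) = (p < q) || (p == q) && (a <= b).
Proof.
move=> ha hb; case: (ltngtP p q) => [h|h|->] /=; last by rewrite leq_add2l.
- apply/idP; have: p.+1 * N <= q * N by rewrite leq_mul2r h orbT.
  rewrite mulSn; lia.
- apply/negbTE; have: q.+1 * N <= p * N by rewrite leq_mul2r h orbT.
  rewrite mulSn; lia.
Qed.

Lemma lexlt p q N a b : a < N -> b < N ->
  p * N + a < q * N + b = (p < q) || (p == q) && (a < b).
Proof.
move=> ha hb; rewrite ltnNge lexle //; lia.
Qed.

Lemma lexeq p q N a b : a < N -> b < N ->
  (p * N + a == q * N + b) = (p == q) && (a == b).
Proof.
move=> ha hb; rewrite eqn_leq !lexle //; lia.
Qed.

Lemma id_lt u : id u < K. 
Proof. by rewrite /K /id ltnS ltnW. Qed.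
Lemma g_lt u : g u < G.
Proof. by rewrite /G ltnS (leq_bigmax u). Qed.

Lemma depth_key_le a b c q a' b' c' q' : a <= m -> a' <= m -> b <= m -> b' <= m ->
   c < G -> c' < G -> q <= K -> q' <= K ->
  (depth_key a b c q <= depth_key a' b' c' q') =
   (a' < a) || (a == a') && ((b < b') || (b == b') && ((c < c') || (c == c') && (q <= q'))).
Proof.
move=> ha ha' hb hb' hc hc' hq hq'.
rewrite /depth_key lexle // !lexlt // !lexeq //.
by clear -ha ha'; lia.
Qed.

Lemma depth_key_lt a b c q : a <= m -> b <= m -> c < G -> q <= K -> depth_key a b c q < depth_bound.
Proof.
move=> ha hb hc hq; rewrite /depth_bound ltnS depth_key_le // ?leqnn //.
by clear -hb hc hq; lia.
Qed.

Lemma abscissa_key_le i s a q i' s' a' q' : s < 3 -> s' < 3 -> a < depth_bound -> a' < depth_bound -> q < K -> q' < K ->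
  (abscissa_key i s a q <= abscissa_key i' s' a' q') =
   (i < i') || (i == i') && ((s < s') || (s == s') && ((a <= a') && ((a' <= a) ==> (q <= q')))).
Proof.
move=> hs hs' ha ha' hq hq'; rewrite /abscissa_key lexle // !lexlt // !lexeq //.
by clear -hs; lia.
Qed.

Lemma depth_bound_sub_le a b : a < depth_bound -> b < depth_bound -> (depth_bound - a.+1 <= depth_bound - b.+1) = (b <= a).
Proof. by move=> ha hb; clear -ha hb; lia. Qed.

Lemma id_inj u v : id u = id v -> u = v.
Proof. by move=> h; apply: enum_rank_inj; apply: val_inj. Qed.

Lemma depth_lt u : depth u < depth_bound.
Proof.
have hg := g_lt u; have reach_hi := id_lt u.
rewrite /depth; have := spine_lt Hok (u := u); have := bridge_lt Hok (u := u). rewrite /spine.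
case: (ro u) => /= h1 h2; apply: depth_key_lt => //; try (move: (h1 isT)); lia.
Qed.

Lemma reach_abscissa u : (reach_lo u <= abscissa u <= reach_hi u) && ((reach_lo u == abscissa u) || (reach_hi u == abscissa u)).
Proof.
have hg := g_lt u; have hid := id_lt u; have hd := depth_lt u.
have := spine_lt Hok (u := u); have := bridge_lt Hok (u := u).
rewrite /reach_lo /reach_hi /abscissa /spine; rewrite /depth in hd *; move: hd.
have K0 : 0 < K by [].
case: (ro u) => /= hd h1 h2; rewrite ?leqnn ?eqxx ?andbT ?orbT //=.
- by rewrite abscissa_key_le //; lia.
- by rewrite abscissa_key_le //; lia.
- have h: depth_key (l u) (r u) (g u) K < depth_bound by apply: depth_key_lt => //; lia.
  by rewrite abscissa_key_le //; lia.
Qed.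

(** By noncrossing, the pairs nested under a horizontal segment start later or end earlier than its
    own pair, so their verticals stop above it. Among verticals sharing an end z_i, the deeper ones
    ending there lie farther right and the deeper ones starting there farther left, which settles
    the ties between pairs. Equal depths occur only among the right arms of one component. *)
Lemma layout_meets u v : u != v ->
  [/\ abscissa u != abscissa v,
     (depth u == depth v) ==> (reach_hi u < reach_lo v) || (reach_hi v < reach_lo u) &
   layout_adj u v = (reach_lo u <= abscissa v <= reach_hi u) && (depth u <= depth v) || (reach_lo v <= abscissa u <= reach_hi v) && (depth v <= depth u)].
Proof.
move=> uv.
have idne : id u <> id v by move=> /id_inj /eqP; rewrite (negbTE uv).
have spine_ne : spine u -> spine v -> l u <> l v.
  by move=> su sv /(spine_inj Hok su sv) /eqP; rewrite (negbTE uv).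
have tie_neu : tie u -> ~~ spine v -> g u <> g v.
  by move=> su sv /(tie_group Hok su sv) /eqP; rewrite (negbTE uv).
have tie_nev : tie v -> ~~ spine u -> g u <> g v.
  by move=> su sv /esym/(tie_group Hok su sv) /eqP; rewrite eq_sym (negbTE uv).
have K0 : 0 < K by [].
have D0 : 0 < depth_bound by [].
have G0 : 0 < G by [].
have gu := g_lt u; have gv := g_lt v; have iu := id_lt u; have iv := id_lt v.
have du := depth_lt u; have dv := depth_lt v.
have := spine_lt Hok (u := u); have := bridge_lt Hok (u := u).
have := spine_lt Hok (u := v); have := bridge_lt Hok (u := v).
have := bridge_nc Hok (u := u) (v := v).
have := bridge_nc Hok (u := v) (v := u).
have := group_lr Hok (u := u) (v := v).
rewrite /reach_lo /reach_hi /abscissa /layout_adj /spine /tie; rewrite /depth in du dv *.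
rewrite /spine /tie in tie_neu tie_nev spine_ne.
move: du dv tie_neu tie_nev spine_ne.
clear -idne K0 D0 G0 gu gv iu iv.
have hDm a : depth_bound - a.+1 < depth_bound by clear -D0; lia.
have hiu q : l u < r u < m -> q <= K -> depth_key (l u) (r u) (g u) q < depth_bound.
  by move=> h1 h2; apply: depth_key_lt => //; clear -h1; lia.
have hiv q : l v < r v < m -> q <= K -> depth_key (l v) (r v) (g v) q < depth_bound.
  by move=> h1 h2; apply: depth_key_lt => //; clear -h1; lia.
have KK : K.-1 < K by [].
have iuK := ltnW iu; have ivK := ltnW iv.
case: (ro u); case: (ro v) => /= du dv tu tv inj gl nc2 nc1 bv sv bu su;
  do ?[move/(_ isT): sv => sv | move/(_ isT): bv => bv];
  do ?[move/(_ isT): su => su | move/(_ isT): bu => bu].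
all: repeat match goal with H : is_true true -> _ |- _ => move/(_ isT): H => H | H : is_true false -> _ |- _ => clear H end.
all: try (have [lu1 lu2] : l u <= m /\ r u <= m by (clear -bu || clear -su); lia).
all: try (have lu1 : l u <= m by (clear -bu || clear -su); lia).
all: try (have [lv1 lv2] : l v <= m /\ r v <= m by (clear -bv || clear -sv); lia).
all: try (have lv1 : l v <= m by (clear -bv || clear -sv); lia).
(* Every comparison of keys becomes a lexicographic comparison of their entries, hence linear
   arithmetic. *)
all: rewrite ?eqn_leq; rewrite ?(ltnNge (abscissa_key _ _ _ _)); rewrite ?abscissa_key_le ?hDm ?hiu ?hiv // ?depth_bound_sub_le ?depth_key_le ?hiu ?hiv //.
all: clear hDm hiu hiv. all: split; rewrite /=. all: try lia.
all: have [iuT ivT] : id u <= #|T| /\ id v <= #|T| by [].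
all: rewrite ?iuT ?ivT ?implybT.
all: have nK : (K <= id u) = false by rewrite leqNgt iu.
all: have nK' : (K <= id v) = false by rewrite leqNgt iv.
all: rewrite ?iuK ?ivK ?nK ?nK' ?leqnn; clear -bu bv nc1 nc2 gl.
(* The goals left concern two vertices off the spine; they are split by whether both lie in one
   component. *)
all: case: (eqVneq (g u) (g v)) gl => [->|ne] gl.
all: try have [e1 e2] := gl erefl.
all: clear gl.
all: lia.
Qed.
End Layout.

(** * Subdivisions of K4 *)

(** Multiplicities turn the distinctness of rearranged concatenations into linear arithmetic for
    [count_lia]. *)
Lemma uniq_countP (T : eqType) (s : seq T) :
  reflect (forall z, count_mem z s <= 1) (uniq s).
Proof.
apply: (iffP idP) => [us z|]; first by rewrite count_uniq_mem ?leq_b1.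
elim: s => //= x s IH h; rewrite IH ?andbT; last first.
  by move=> z; apply: leq_trans (h z); rewrite leq_addl.
by have := h x; rewrite eqxx -has_pred1 has_count; lia.
Qed.

Lemma count_mem_gt0 (T : eqType) (z : T) s : (0 < count_mem z s) = (z \in s).
Proof. by rewrite -has_count has_pred1. Qed.

Lemma count_mem_eq0 (T : eqType) (z : T) s : (count_mem z s == 0) = (z \notin s).
Proof. by rewrite -count_mem_gt0 eqn0Ngt. Qed.

Definition count_simp :=
  (count_cat, count_rev, fun T a x (s : seq T) => erefl : count a (x :: s) = a x + count a s,
   fun T (a : pred T) => erefl : count a [::] = 0,
   fun (T : eqType) (x y : T) => erefl : pred1 x y = (y == x)).

(* Generalizing the counts first keeps the arithmetic problems small. *)
Ltac count_lia :=
  rewrite ?count_simp;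
  repeat match goal with |- context [count ?a ?s] => move: (count a s) => ? end;
  repeat match goal with |- context [nat_of_bool ?b] =>
    lazymatch b with true => fail | false => fail | _ => tryif is_var b then fail else move: b => ? end end;
  clear; lia.

Section SubdivisionOfK4.
Variables (T : finType) (e : rel T).
Hypothesis e_sym : symmetric e.

(** [P] holds the inner vertices only, so links concatenate at a shared vertex without repeating it
    and are reversed by [rev]. *)
Definition link (u : T) (P : seq T) (v : T) : bool := path e u (rcons P v).

Lemma link0 u v : link u [::] v = e u v.
Proof. by rewrite /link /= andbT. Qed.

Lemma link_cons u x P v : link u (x :: P) v = e u x && link x P v.
Proof. by []. Qed.

Lemma link_cat u P w Q v : link u (P ++ w :: Q) v = link u P w && link w Q v.
Proof. by rewrite /link rcons_cat rcons_cons -cat_rcons cat_path last_rcons. Qed.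

Lemma link_rcons u P w v : link u (rcons P w) v = link u P w && e w v.
Proof. by rewrite -cats1 link_cat link0. Qed.

Lemma link_rev u P v : link u (rev P) v = link v P u.
Proof.
elim/last_ind: P u v => [|P x IH] u v; first by rewrite !link0 e_sym.
by rewrite rev_rcons link_cons IH link_rcons andbC e_sym.
Qed.

Lemma cycle_link u P : cycle e (u :: P) = link u P u.
Proof. by []. Qed.

Lemma uniq_flatten_nth (ss : seq (seq T)) a b v : uniq (flatten ss) ->
  v \in nth [::] ss a -> v \in nth [::] ss b -> a = b.
Proof.
have inflat c (tt : seq (seq T)) : v \in nth [::] tt c -> v \in flatten tt.
  move=> h; apply/flattenP; exists (nth [::] tt c) => //; apply: mem_nth.
  by case: ltnP h => // /(nth_default [::]) ->.
elim: ss a b => [|s ss IH] [|a] [|b] //=; rewrite cat_uniq => /and3P[us /hasPn h uss].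
- by move=> vs /inflat /h; rewrite vs.
- by move=> /inflat /h + vs; rewrite /= vs.
- by move=> ha hb; rewrite (IH a b).
Qed.

Lemma uniq_nth_flatten (ss : seq (seq T)) c : uniq (flatten ss) -> uniq (nth [::] ss c).
Proof.
elim: ss c => [|s ss IH] [|c] //=; rewrite cat_uniq => /and3P[us _ uss] //.
exact: IH.
Qed.

Lemma K4_intro b0 b1 b2 b3 p01 p02 p03 p12 p13 p23 :
  link b0 p01 b1 -> link b0 p02 b2 -> link b0 p03 b3 ->
  link b1 p12 b2 -> link b1 p13 b3 -> link b2 p23 b3 ->
  uniq ([:: b0; b1; b2; b3] ++ p01 ++ p02 ++ p03 ++ p12 ++ p13 ++ p23) ->
  has_K4_subdivision e.
Proof.
move=> l01 l02 l03 l12 l13 l23 un.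
pose ss := [:: [:: b0]; [:: b1]; [:: b2]; [:: b3]; p01; p02; p03; p12; p13; p23].
have {}un : uniq (flatten ss) by rewrite /= cats0.
have key := uniq_flatten_nth un.
(* [code i j] is the position in [ss] of the path from [b i] to [b j]. Positions 0 to 3 hold the
   branch vertices, and the zeros are padding for [j <= i]. *)
pose code (i j : 'I_4) := nth 0 (nth [::]
  [:: [:: 0; 4; 5; 6]; [:: 0; 0; 7; 8]; [:: 0; 0; 0; 9]] i) j.
pose b (i : 'I_4) := nth b0 [:: b0; b1; b2; b3] i.
have inb (i : 'I_4) : b i \in nth [::] ss i.
  by rewrite /b; case: i => [[|[|[|[|]]]]] // ?; exact: mem_head.
have code4 (i j : 'I_4) : i < j -> 4 <= code i j.
  by case: i => [[|[|[|[|]]]]] //= ?; case: j => [[|[|[|[|]]]]].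
have uss c : uniq (nth [::] ss c) by exact: uniq_nth_flatten.
have intE (i j : 'I_4) v : v \in interior (rcons (nth [::] ss (code i j)) (b j)) (b j) ->
    v \in nth [::] ss (code i j).
  by rewrite unfold_in /interior mem_rcons inE; case: eqP; rewrite ?andbF ?andbT.
exists b, (fun i j => rcons (nth [::] ss (code i j)) (b j)); split.
- by move=> i j bij; apply/val_inj/(key _ _ (b i)); rewrite // bij.
- move=> i j ij; apply/and3P; split; last 1 first.
  + rewrite /= mem_rcons inE negb_or rcons_uniq uss andbT -andbA; apply/and3P; split.
    * apply/eqP => bij; move: ij; have -> : nat_of_ord i = j.
        by apply: (key _ _ (b i)); rewrite // bij.
      by rewrite ltnn.
    * apply/negP => /(key _ _ _ (inb i)) h; have := code4 _ _ ij; rewrite -h; by have := ltn_ord i; lia.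
    * apply/negP => /(key _ _ _ (inb j)) h; have := code4 _ _ ij; rewrite -h; by have := ltn_ord j; lia.
  + by move: ij; rewrite /b /code; case: i => [[|[|[|[|]]]]] //= ?; case: j => [[|[|[|[|]]]]].
  + by rewrite last_rcons.
- move=> i j k v ij /intE vij; apply/eqP => vk; rewrite vk in vij.
  have h := key _ _ _ vij (inb k); have := code4 _ _ ij; have := ltn_ord k; lia.
- move=> i j i' j' v ij ij' ne /intE vij; apply/negP => /intE vij'.
  move: (key _ _ _ vij vij') ij ij' ne; clear; rewrite /code.
  case: i => [[|[|[|[|]]]]] //= ?; case: j => [[|[|[|[|]]]]] //= ?;
  by case: i' => [[|[|[|[|]]]]] //= ?; case: j' => [[|[|[|[|]]]]] //= ?; rewrite eqE /= !eqE.
Qed.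

(** The branch vertices are [u], [x], [v], [y]: the cycle supplies four of the six paths, [P] and
    [Q] the two diagonals. *)
Lemma K4_crossing u A x B v C y D P Q :
  cycle e (u :: A ++ x :: B ++ v :: C ++ y :: D) -> link u P v -> link x Q y ->
  uniq ((u :: A ++ x :: B ++ v :: C ++ y :: D) ++ P ++ Q) ->
  has_K4_subdivision e.
Proof.
rewrite cycle_link !link_cat => /and4P[lA lB lC lD] lP lQ un.
apply: (@K4_intro u x v y A P (rev D) B Q C) => //; first by rewrite link_rev.
rewrite (perm_uniq (_ : perm_eq _ ((u :: A ++ x :: B ++ v :: C ++ y :: D) ++ P ++ Q))) //.
apply/permP => a; count_lia.
Qed.

(** The branch vertices are the three feet on the cycle and the centre [c]. *)
Lemma K4_tripod u A v B w C c P Q R :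
  cycle e (u :: A ++ v :: B ++ w :: C) ->
  link c P u -> link c Q v -> link c R w ->
  uniq ((u :: A ++ v :: B ++ w :: C) ++ c :: P ++ Q ++ R) ->
  has_K4_subdivision e.
Proof.
rewrite cycle_link !link_cat => /and3P[lA lB lC] lP lQ lR un.
apply: (@K4_intro u v w c A (rev C) (rev P) B (rev Q) (rev R)); rewrite ?link_rev //.
rewrite (perm_uniq (_ : perm_eq _ ((u :: A ++ v :: B ++ w :: C) ++ c :: P ++ Q ++ R))) //.
apply/permP => a; count_lia.
Qed.

End SubdivisionOfK4.

(** * Paths and components after deleting a set of vertices *)

Section Links.
Variables (T : finType) (e : rel T).
Hypothesis e_sym : symmetric e.
Implicit Types (S : {set T}) (x y z : T) (p q : seq T).

Lemma restr_sym S : symmetric (restr e S).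
Proof. by move=> x y; rewrite /restr e_sym andbCA. Qed.

Lemma connect_restr_sym S : connect_sym (restr e S).
Proof. exact: sym_connect_sym (restr_sym S). Qed.

Lemma path_restr S x p : x \notin S ->
  path (restr e S) x p = path e x p && all (fun z => z \notin S) p.
Proof.
elim: p x => //= y p IH x xS; rewrite /restr xS /=.
by case yS: (y \in S); rewrite /= ?andbF //= IH ?yS // andbA.
Qed.

Lemma mem_comp S x y : (y \in Defs.comp e S x) = connect (restr e S) x y.
Proof. by rewrite inE. Qed.

Lemma compP S x y : y \in Defs.comp e S x -> Defs.comp e S y = Defs.comp e S x.
Proof.
rewrite mem_comp => xy; apply/setP => z; rewrite !mem_comp.
exact/esym/(same_connect (@connect_restr_sym S)).
Qed.

Lemma comp_refl S x : x \in Defs.comp e S x.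
Proof. by rewrite mem_comp connect0. Qed.

Lemma comp_step S x y z : y \in Defs.comp e S x -> e y z -> y \notin S -> z \notin S ->
  z \in Defs.comp e S x.
Proof.
rewrite !mem_comp => xy eyz yS zS; apply: (connect_trans xy); apply: connect1.
by rewrite /restr yS zS.
Qed.

Lemma comp_notin S x y : x \notin S -> y \in Defs.comp e S x -> y \notin S.
Proof.
rewrite mem_comp => xS /connectP[p]; elim/last_ind: p => [|p z _] /=; first by move=> _ ->.
by rewrite rcons_path last_rcons => /andP[_ /and3P[]] + + + -> .
Qed.

Lemma path_comp S x p : x \notin S -> path e x p -> all (fun z => z \notin S) p ->
  {subset x :: p <= Defs.comp e S x}.
Proof.
move=> xS px pS y yp; rewrite mem_comp; apply: (@path_connect _ _ _ p) => //.
by rewrite path_restr // px.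
Qed.

Lemma connect_path S x y : x \notin S -> connect (restr e S) x y ->
  exists p, [/\ path e x p, last x p = y, uniq (x :: p) & all (fun z => z \notin S) p].
Proof.
move=> xS /connectP[p /shortenP[p' px' un _] ->]; exists p'.
by move: px'; rewrite path_restr // => /andP[].
Qed.

Lemma first_hit (Y : pred T) x p : path e x p -> has Y p ->
  exists q y p2, [/\ p = q ++ y :: p2, link e x q y, Y y & ~~ has Y q].
Proof.
move=> px hp; case: (split_find hp) px => y q p2 Yy nq; rewrite cat_path => /andP[px _].
by exists q, y, p2; rewrite cat_rcons.
Qed.

(** Cut a path from [a] to [b] at its first vertex in [Y], then walk back from there to the nearest
    vertex in [X]. *)
Lemma link_between S (X Y : seq T) a b : a \notin S -> connect (restr e S) a b ->
  a \in X -> b \in Y -> (forall z, z \in X -> z \notin Y) ->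
  exists x q y, [/\ x \in X, y \in Y, link e x q y, uniq q &
   forall z, z \in q -> [/\ z \notin S, z \notin X & z \notin Y]].
Proof.
move=> aS /(connect_path aS)[p [pa lp un pS]] Xa Yb XY.
have hY : has (mem Y) p.
  case: p lp {pa un pS} => [|c p] lp; first by move: Yb; rewrite -lp /= (negbTE (XY _ Xa)).
  by apply/hasP; exists b => //; rewrite -lp /= mem_last.
have [q [y [p2 [pE lq Yy nq]]]] := first_hit pa hY.
have : link e y (rev q) a by rewrite link_rev.
have hX : has (mem X) (rcons (rev q) a) by rewrite has_rcons /= Xa.
move=> /first_hit /(_ hX)[q' [x [p3 [qE lq' Xx nq']]]].
have qq' : {subset q' <= q}.
  move=> z zq'; have : z \in rcons (rev q) a by rewrite qE mem_cat zq'.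
  rewrite mem_rcons inE mem_rev => /orP[/eqP za|//].
  by move/hasPn: nq' => /(_ z zq'); rewrite za /= Xa.
exists x, (rev q'), y; split => //.
- by rewrite link_rev.
- rewrite rev_uniq; have : uniq (rcons (rev q) a).
    move: un; rewrite pE rcons_uniq mem_rev rev_uniq /= mem_cat cat_uniq negb_or.
    by case/and3P => /andP[-> _] -> _.
  by rewrite qE cat_uniq => /and3P[].
- move=> z; rewrite mem_rev => zq'; split.
  + move/allP: pS; apply; rewrite pE mem_cat (qq' _ zq') //.
  + by move/hasPn: nq'; apply.
  + by move/hasPn: nq; apply; apply: qq'.
Qed.

End Links.

(** * Cycles have no chords *)

Section Chordless.
Variables (T : finType) (e : rel T).
Hypothesis e_sym : symmetric e.
Hypothesis e_irr : irreflexive e.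
Hypothesis noK4 : ~ has_K4_subdivision e.
Hypothesis nte : no_transitive_edges e.

Lemma chordless u A v B : link e u A v -> link e v B u ->
  uniq (u :: A ++ v :: B) -> A != [::] -> B != [::] -> ~~ e u v.
Proof.
move=> lA lB un A0 B0; apply/negP => euv.
have uv : u != v by apply: contraTneq euv => ->; rewrite e_irr.
case: A A0 lA un => // a A _ lA un; case: B B0 lB un => // b B _ lB un.
have un' := elimT (uniq_countP _) un.
have [aS bS] : a \notin [set u; v] /\ b \notin [set u; v].
  have := un' u; have := un' v; rewrite !inE !count_simp !eqxx; count_lia.
(* If the two arcs were not connected, [u] and [v] would separate the graph and [u v] would be a
   transitive edge. *)
have [cab|ncab] := boolP (connect (restr e [set u; v]) a b); last first.
  by apply: (@nte u v euv); split => // /(_ a b aS bS); rewrite (negbTE ncab).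
have [|x [q [y [Xx Yy lq uq hq]]]] := link_between e_sym (X := a :: A) (Y := b :: B) aS cab
   (mem_head _ _) (mem_head _ _).
  move=> z /= zA; have := un' z; move: zA; rewrite -count_mem_eq0 -count_mem_gt0; count_lia.
case: (path.splitPr Xx) lA un un' hq => A1 A2 lA un un' hq.
case: (path.splitPr Yy) lB un un' hq => B1 B2 lB un un' hq.
apply: noK4.
(* The chord itself is the first diagonal, with no inner vertex. *)
apply: (@K4_crossing _ _ e_sym u A1 x A2 v B1 y B2 [::] q) => //.
- by move: lA lB; rewrite cycle_link !link_cat => /andP[-> ->] /andP[-> ->].
- by rewrite link0.
- apply/uniq_countP => z; have := un' z.
  have uqz := elimT (uniq_countP _) uq z.
  have [/hq [zS zA zB]|] := boolP (z \in q); last first.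
    by rewrite -count_mem_eq0; count_lia.
  by move: zS zA zB uqz; rewrite -!count_mem_eq0 !inE ![z == _]eq_sym; count_lia.
Qed.
End Chordless.

(** * Paths through a prescribed vertex of a biconnected graph *)

Section Fans.
Variables (T : finType) (e : rel T).
Hypothesis e_sym : symmetric e.
Hypothesis e_irr : irreflexive e.
Hypothesis bi : biconnected e.

(** If [y'] is off the path, append it; if it comes at or after [x], cut the path there. Otherwise
    [y'] precedes [x], and since [y'] is no cut vertex, a detour [q] leads from the part before [y']
    to a vertex [b] in the part after it. *)
Lemma path_through_step s x y y' P :
  link e s P y -> uniq (s :: rcons P y) -> x \in rcons P y -> e y y' -> y' != s ->
  exists P', [/\ link e s P' y', uniq (s :: rcons P' y') & x \in rcons P' y'].
Proof.
move=> lP un xP eyy' y's; have un' := elimT (uniq_countP _) un.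
have yy' : y != y' by apply: contraTneq eyy' => ->; rewrite e_irr.
have [y'P|y'P] := boolP (y' \in P); last first.
  exists (rcons P y); split; first by rewrite link_rcons lP.
    apply/uniq_countP => z; have := un' z; move: y'P.
    rewrite -!cats1 -count_mem_eq0 => y'P.
    have [->|zy'] := eqVneq z y'.
      by move: y'P y's yy'; rewrite !count_simp eqxx !(eq_sym y'); count_lia.
    by rewrite !count_simp (eq_sym y' z) (negbTE zy'); count_lia.
  by rewrite mem_rcons inE xP orbT.
case: (path.splitPr y'P) lP un un' xP => P1 P2 lP un un' xP.
move: lP; rewrite link_cat => /andP[l1 l2].
have [xP1|xP1] := boolP (x \in rcons P1 y').
  exists P1; split => //; apply/uniq_countP => z; have := un' z.
  by rewrite -!cats1; count_lia.
have xK : x \in rcons P2 y.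
  by move: xP xP1; rewrite !(mem_cat, inE, mem_rcons); case: (x == y) (x \in P1) (x == y') (x \in P2) => [] [] [] [].
have [_ _ /(_ y') cy'] := bi.
have /link_between : s \notin [set y'] by rewrite inE eq_sym.
have yS : y \notin [set y'] by rewrite inE.
have sS : s \notin [set y'] by rewrite inE eq_sym.
move=> /(_ e e_sym (s :: P1) (rcons P2 y) y (cy' _ _ sS yS)).
rewrite mem_head mem_rcons mem_head => /(_ isT isT)[].
  move=> z; rewrite -count_mem_gt0 -count_mem_eq0; have := un' z.
  by rewrite -!cats1; count_lia.
move=> a [q [b [aP1 bK lq uq hq]]].
have [pre [A2 [pE lpre lastpre]]] : exists pre A2, [/\ P1 = pre ++ A2, path e s pre & last s pre = a].
  have pP1 : path e s P1 by move: l1; rewrite /link rcons_path => /andP[].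
  move: aP1; rewrite inE => /orP[/eqP ->|aP1]; first by exists [::], P1.
  case: (path.splitPr aP1) pP1 => A1 A2; rewrite -cat_rcons cat_path => /andP[h _].
  by exists (rcons A1 a), A2; rewrite last_rcons cat_rcons.
have uqz := elimT (uniq_countP _) uq.
have y'q z : z \in q -> z != y' by move=> /hq[]; rewrite inE.
have [K1 [K2 KE]] : exists K1 K2, rcons P2 y = K1 ++ b :: K2.
  by case: (path.splitPr bK) => K1 K2; exists K1, K2.
have pK : path e y' (K1 ++ b :: K2) by rewrite -KE.
have lK : last b K2 = y by have := last_rcons y' P2 y; rewrite KE last_cat.
move: pK; rewrite -cat_rcons cat_path last_rcons => /andP[pK1 pK2].
have cnt z : count_mem z (s :: P1 ++ y' :: K1 ++ b :: K2) <= 1.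
  by have := un' z; rewrite -[K1 ++ _]KE -!cats1; count_lia.
have cnt' z : z \in q -> count_mem z (s :: P1 ++ y' :: K1 ++ b :: K2) = 0.
  move=> zq; have := y'q z zq; have [_ + +] := hq z zq.
  rewrite KE -!count_mem_eq0 (eq_sym z y'); count_lia.
(* If [x] is not before [b], continue from [b] to [y] and take the edge to [y']. *)
have [xF|xF] := boolP (x \in b :: K2).
  exists (pre ++ q ++ b :: K2); split.
  - rewrite /link -cats1 -!catA cat_path lpre lastpre /= -cat_rcons cat_path last_rcons.
    by move: lq; rewrite /link => -> /=; rewrite cat_path pK2 lK /= eyy'.
  - apply/uniq_countP => z; have := cnt z; have := cnt' z; have := uqz z.
    case: (boolP (z \in q)) => [_ + /(_ isT)|]; last rewrite -count_mem_eq0.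
      by rewrite pE -!cats1; count_lia.
    by rewrite pE -!cats1 => + + _; count_lia.
  - by rewrite mem_rcons inE !mem_cat xF !orbT.
(* If [x] lies between [y'] and [b], return from [b] to [y'] along the old path backwards. *)
have xK1 : x \in K1.
  by move: xK; rewrite KE mem_cat (negbTE xF) orbF.
exists (pre ++ q ++ b :: rev K1); split.
- rewrite /link -cats1 -!catA cat_path lpre lastpre /= -cat_rcons cat_path last_rcons.
  move: lq; rewrite /link => -> /=; rewrite cats1.
  by have := link_rev e_sym b K1 y'; rewrite /link => ->.
- apply/uniq_countP => z; have := cnt z; have := cnt' z; have := uqz z.
  case: (boolP (z \in q)) => [_ + /(_ isT)|]; last rewrite -count_mem_eq0.
    by rewrite pE -!cats1; count_lia.
  by rewrite pE -!cats1 => + + _; count_lia.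
- by rewrite mem_rcons inE !mem_cat inE mem_rev xK1 !orbT.
Qed.

(** Start with a path from [s] to [x] and push its end to [t], one edge at a time, along a path that
    avoids [s]. *)
Lemma path_through s x t : s != t -> x != s -> x != t ->
  exists P, [/\ link e s P t, uniq (s :: rcons P t) & x \in P].
Proof.
move=> st xs xt; have [_ c0 c1] := bi.
have xS : x \notin [set s] by rewrite inE.
have tS : t \notin [set s] by rewrite inE eq_sym.
suff [P [lP un xP]] : exists P, [/\ link e s P t, uniq (s :: rcons P t) & x \in rcons P t].
  by exists P; split => //; move: xP; rewrite mem_rcons inE (negbTE xt).
have [p [px lp _ pS]] := connect_path xS (c1 s _ _ xS tS).
rewrite -lp; elim/last_ind: p px pS {lp} => [|p y IH] /=.
  move=> _ _; have s0 z : z \notin (finset.set0 : {set T}) by rewrite inE.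
  have [q [qs lq uq _]] := connect_path (s0 s) (c0 s x (s0 _) (s0 _)).
  case/lastP: q qs lq uq => [_ /= sx|q y]; first by move: xs; rewrite -sx eqxx.
  rewrite last_rcons => qs yx uq; rewrite yx in qs uq; exists q; split => //.
  by rewrite mem_rcons mem_head.
rewrite rcons_path last_rcons all_rcons => /andP[px exy] /andP[yS pS].
have [P [lP un xP]] := IH px pS.
by apply: (path_through_step lP un xP exy); rewrite inE in yS.
Qed.

(** The inner vertices of a path through [x] avoid [s] and [t], so they never leave the component of
    [x]. *)
Lemma ear_through s x t : s != t -> x \notin [set s; t] ->
  exists P, [/\ link e s P t, uniq (s :: rcons P t), x \in P &
    {subset P <= Defs.comp e [set s; t] x}].
Proof.
move=> st; rewrite !inE negb_or => /andP[xs xt].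
have [P [lP un xP]] := path_through st xs xt; exists P; split => //.
have un' := elimT (uniq_countP _) un.
have PS : all (fun z => z \notin [set s; t]) P.
  apply/allP => z; rewrite !inE -count_mem_gt0 !(eq_sym z).
  by have := un' z; rewrite -cats1; count_lia.
have pP : path e s P by move: lP; rewrite /link rcons_path => /andP[].
case: P xP pP PS {lP un un'} => // p P xP /= /andP[_ pP] /andP[pS PS] y yP.
have sub := path_comp pS pP PS.
by rewrite (compP e_sym (sub _ xP)); exact: sub.
Qed.

End Fans.

(** * Mutually nonadjacent arms from three heavy components *)

Section Arms.
Variables (T : finType) (e : rel T).
Hypothesis e_sym : symmetric e.
Hypothesis e_irr : irreflexive e.
Hypothesis bi : biconnected e.
Hypothesis noK4 : ~ has_K4_subdivision e.
Hypothesis nte : no_transitive_edges e.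

Lemma chordless_ear s t A u B D : link e s (A ++ u :: B) t -> link e t D s ->
  uniq (s :: (A ++ u :: B) ++ t :: D) -> A != [::] -> ~~ e s u.
Proof.
move=> + lD un A0; rewrite link_cat => /andP[lA lB].
apply: (chordless e_sym e_irr noK4 nte lA (B := B ++ t :: D)) => //; last by case: (B).
  by rewrite link_cat lB.
by move: un; rewrite -catA.
Qed.

Lemma chordless_ear_rev s t A u B D : link e s (A ++ u :: B) t -> link e t D s ->
  uniq (s :: (A ++ u :: B) ++ t :: D) -> B != [::] -> ~~ e t u.
Proof.
move=> lP lD un B0; apply: (@chordless_ear t s (rev B) u (rev A) (rev D)).
- by rewrite -[_ ++ _](_ : rev (A ++ u :: B) = _) ?link_rev // rev_cat rev_cons cat_rcons.
- by rewrite link_rev.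
- apply/uniq_countP => z; have := elimT (uniq_countP _) un z; count_lia.
- by rewrite -size_eq0 size_rev size_eq0.
Qed.

Variables s t : T.
Hypothesis st : s != t.

(** The data sit in one tuple so that ears for all three components are chosen by a single use of
    [fin_all_exists]. *)
Definition heavy_ear (C : {set T}) (d : T * (seq T * seq T)) : Prop :=
  let: (x, (P1, P2)) := d in
  [/\ C = Defs.comp e [set s; t] x, link e s (P1 ++ x :: P2) t,
      uniq (s :: rcons (P1 ++ x :: P2) t),
      {subset P1 ++ x :: P2 <= C} & ~~ e s x && ~~ e t x].

Lemma heavy_earP C : C \in heavy_components e s t -> exists d, heavy_ear C d.
Proof.
move=> /imsetP[x]; rewrite inE => /and3P[xS sx tx] ->.
have [P [lP un xP sub]] := ear_through e_sym e_irr bi st xS.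
case: (path.splitPr xP) lP un sub => P1 P2 lP un sub.
by exists (x, (P1, P2)); split => //; rewrite sx.
Qed.

Lemma uniq_theta C C' P Q : C != C' ->
  (exists2 x, C = Defs.comp e [set s; t] x & x \notin [set s; t]) ->
  (exists2 x, C' = Defs.comp e [set s; t] x & x \notin [set s; t]) ->
  uniq (s :: rcons P t) -> uniq (s :: rcons Q t) ->
  {subset P <= C} -> {subset Q <= C'} -> uniq (s :: P ++ t :: rev Q).
Proof.
move=> CC' [x xE xS] [y yE yS] /uniq_countP uP /uniq_countP uQ PC QC.
apply/uniq_countP => z; have := uP z; have := uQ z; rewrite -!cats1.
have [zP|] := boolP (z \in P); last by rewrite -count_mem_eq0; count_lia.
have : z \notin Q.
  apply/negP => zQ; case/eqP: CC'; have := PC z zP; have := QC z zQ.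
  by rewrite xE yE => /(compP e_sym) <- /(compP e_sym) <-.
by rewrite -count_mem_eq0; count_lia.
Qed.

Lemma comp_apart x y u v : x \notin [set s; t] -> y \notin [set s; t] ->
  Defs.comp e [set s; t] x != Defs.comp e [set s; t] y ->
  u \in Defs.comp e [set s; t] x -> v \in Defs.comp e [set s; t] y ->
  u != v /\ ~~ e u v.
Proof.
move=> xS yS ne ux vy; have uS := comp_notin xS ux; have vS := comp_notin yS vy.
have euE := compP e_sym ux; have evE := compP e_sym vy; split.
  by apply: contraNneq ne => uv; rewrite -euE -evE uv.
apply: contraNN ne => euv; rewrite -euE -evE eq_sym; apply/eqP/(compP e_sym).
by apply: comp_step euv _ _ => //; exact: comp_refl.
Qed.

(** The two ears form a cycle. Its lack of chords keeps [s] away from [P2] and from [t], and [t]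
    away from [Q1]; [x] and [y] are adjacent to neither end by choice; the inner vertices lie in
    different components. *)
Lemma heavy_ears_apart C C' x P1 P2 y Q1 Q2 : C != C' ->
  heavy_ear C (x, (P1, P2)) -> heavy_ear C' (y, (Q1, Q2)) ->
  forall u v, u \in x :: rcons P2 t -> v \in y :: rcons (rev Q1) s -> u != v /\ ~~ e u v.
Proof.
move=> CC' [CE lP uP PC /andP[sx tx]] [CE' lQ uQ QC /andP[sy ty]] u v.
have xS : x \notin [set s; t].
  have := elimT (uniq_countP _) uP x; rewrite !inE !(eq_sym x) -!cats1 count_simp.
  by rewrite !count_simp eqxx; count_lia.
have yS : y \notin [set s; t].
  have := elimT (uniq_countP _) uQ y; rewrite !inE !(eq_sym y) -!cats1 count_simp.
  by rewrite !count_simp eqxx; count_lia.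
have un : uniq (s :: (P1 ++ x :: P2) ++ t :: rev (Q1 ++ y :: Q2)).
  by apply: (uniq_theta CC') uP uQ PC QC; [exists x | exists y].
have lQ' : link e t (rev (Q1 ++ y :: Q2)) s by rewrite link_rev.
have n0 (A B : seq T) (z : T) : A ++ z :: B != [::] by case: A.
have nst : ~~ e s t.
  apply: (chordless e_sym e_irr noK4 nte lP lQ' un) => //.
  by rewrite rev_cat rev_cons cat_rcons n0.
have inC z : z \in x :: P2 -> z \in C by move=> zP; apply: PC; rewrite mem_cat zP orbT.
have inC' z : z \in y :: rev Q1 -> z \in C'.
  by rewrite inE mem_rev => zQ; apply: QC; rewrite mem_cat inE orbCA orbA zQ.
have sC : s \notin C by rewrite CE; apply/negP => /(comp_notin xS); rewrite !inE eqxx.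
have tC' : t \notin C' by rewrite CE'; apply/negP => /(comp_notin yS); rewrite !inE eqxx orbT.
rewrite -[x :: _]rcons_cons -[y :: _]rcons_cons !mem_rcons.
rewrite ![_ \in _ :: _ :: _]in_cons.
case/orP => [/eqP ->|uP2]; case/orP => [/eqP ->|vQ1].
- by rewrite eq_sym e_sym.
- split; first by apply: contraNneq tC' => ->; exact: inC'.
  move: vQ1; rewrite inE => /orP[/eqP ->//|]; rewrite mem_rev => vQ1.
  have unQ : uniq (s :: (Q1 ++ y :: Q2) ++ t :: rev (P1 ++ x :: P2)).
    by apply: (uniq_theta _ _ _ uQ uP QC PC); [rewrite eq_sym | exists y | exists x].
  case: (path.splitPr vQ1) lQ unQ => Q11 Q12 lQ unQ.
  have QE : (Q11 ++ v :: Q12) ++ y :: Q2 = Q11 ++ v :: (Q12 ++ y :: Q2) by rewrite -catA.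
  rewrite QE in lQ unQ.
  by apply: chordless_ear_rev lQ _ unQ _; rewrite ?link_rev // -cat_cons n0.
- split; first by apply: contraNneq sC => <-; exact: inC.
  rewrite e_sym; move: uP2; rewrite inE => /orP[/eqP ->//|uP2].
  case: (path.splitPr uP2) lP un => P21 P22 lP un.
  have PE : P1 ++ x :: (P21 ++ u :: P22) = (P1 ++ x :: P21) ++ u :: P22 by rewrite -catA.
  rewrite PE in lP un.
  by apply: chordless_ear lP lQ' un _; rewrite n0.
- by apply: (comp_apart xS yS); rewrite -?CE -?CE' ?inC ?inC'.
Qed.

Lemma heavy_arms : 2 < #|heavy_components e s t| ->
  exists (x : 'I_3 -> T) (p q : 'I_3 -> seq T),
  [/\ forall i, path e (x i) (p i) /\ last (x i) (p i) = t,
      forall i, path e (x i) (q i) /\ last (x i) (q i) = s &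
      forall i j, i != j -> forall u v, u \in x i :: p i -> v \in x j :: q j ->
        u != v /\ ~~ e u v].
Proof.
move=> /card_gt2P[C0 [C1 [C2 [[h0 h1 h2] [n01 n12 n20]]]]].
pose C (i : 'I_3) := nth C0 [:: C0; C1; C2] i.
have hC i : C i \in heavy_components e s t by case: i => [[|[|[|]]]].
have nC i j : i != j -> C i != C j.
  by case: i => [[|[|[|]]]] //= ?; case: j => [[|[|[|]]]] //= ?; rewrite /C /= // eq_sym.
have [d hd] := fin_all_exists (fun i => heavy_earP (hC i)).
exists (fun i => (d i).1), (fun i => rcons (d i).2.2 t), (fun i => rcons (rev (d i).2.1) s); split.
- move=> i; have := hd i; case: (d i) => x [P1 P2] [_ lP _ _ _] /=; rewrite last_rcons.
  by move: lP; rewrite link_cat => /andP[].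
- move=> i; have := hd i; case: (d i) => x [P1 P2] [_ lP _ _ _] /=; rewrite last_rcons.
  by move: lP; rewrite link_cat => /andP[l _]; rewrite -/(link _ _ _ _) link_rev.
- move=> i j /nC ne; have := hd i; have := hd j.
  case: (d i) => x [P1 P2]; case: (d j) => y [Q1 Q2] hj hi.
  exact: heavy_ears_apart ne hi hj.
Qed.
End Arms.

(** * Attachments of the components of G - Z *)

Section Cycles.
Variables (T : finType) (e : rel T).
Hypothesis e_sym : symmetric e.
Hypothesis e_irr : irreflexive e.
Hypothesis bi : biconnected e.
Hypothesis noK4 : ~ has_K4_subdivision e.
Hypothesis nte : no_transitive_edges e.

Definition longest_cycle (Z : seq T) : Prop :=
  [/\ cycle e Z, uniq Z, 2 < size Z &
   forall Z', cycle e Z' -> uniq Z' -> size Z' <= size Z].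

Lemma longest_cycle_rot n Z : longest_cycle Z -> longest_cycle (rot n Z).
Proof. by move=> [cZ uZ sZ mZ]; split; rewrite ?rot_cycle ?rot_uniq ?size_rot. Qed.

Lemma longest_cycle_catC A B : longest_cycle (A ++ B) -> longest_cycle (B ++ A).
Proof. by move=> /(longest_cycle_rot (size A)); rewrite rot_size_cat. Qed.

(** Some edge exists; a path between its ends through a third vertex closes up with it. *)
Lemma exists_long_cycle : exists Z, [/\ cycle e Z, uniq Z & 2 < size Z].
Proof.
have [T3 c0 _] := bi.
have /card_gt2P[s [y [x [_ [sy yx xs]]]]] : 2 < #|[set: T]| by rewrite cardsT.
have s0 z : z \notin (finset.set0 : {set T}) by rewrite inE.
have [p [ps lp _ _]] := connect_path (s0 s) (c0 s y (s0 _) (s0 _)).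
case: p ps lp => [_ /= sy'|t p /= /andP[est _] _]; first by rewrite sy' eqxx in sy.
have st : s != t by apply: contraTneq est => ->; rewrite e_irr.
have [x' x's x't] : exists2 x', x' != s & x' != t.
  have [xt|xt] := eqVneq x t; last by exists x.
  by exists y; rewrite -?xt // eq_sym.
have [P [lP un xP]] := path_through e_sym e_irr bi st x's x't.
exists (s :: rcons P t); split => //.
  rewrite cycle_link; move: lP; rewrite /link => lP.
  by rewrite rcons_path lP last_rcons e_sym.
by case: P xP {lP un} => // ? ?; rewrite /= size_rcons.
Qed.

Lemma exists_longest_cycle : exists Z, longest_cycle Z.
Proof.
pose P n := [exists t : n.-tuple T, cycle e t && uniq t].
have bound n : P n -> n <= #|T|.
  move=> /existsP[t /andP[_ ut]].
  by rewrite -(size_tuple t) -(card_uniqP ut) max_card.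
have [Z0 [cZ0 uZ0 sZ0]] := exists_long_cycle.
have PZ Z : cycle e Z -> uniq Z -> P (size Z).
  by move=> cZ uZ; apply/existsP; exists (in_tuple Z); rewrite cZ.
have ex : exists n, P n by exists (size Z0); exact: PZ.
have [n /existsP[t /andP[ct ut]] mx] := ex_maxnP ex bound.
exists t; split => //; rewrite size_tuple.
  by apply: leq_trans sZ0 (mx _ _); exact: PZ.
by move=> Z' cZ' uZ'; apply: mx; exact: PZ.
Qed.

Lemma split_cycle (s t : T) Z : s != t -> s \in Z -> t \in Z ->
  exists n A B, rot n Z = s :: A ++ t :: B.
Proof.
move=> st sZ tZ; have [n Z' ZE] := rot_to sZ.
have : t \in Z' by move: tZ; rewrite -(mem_rot n) ZE inE eq_sym (negbTE st).
by move=> tZ'; case: (path.splitPr tZ') ZE => A B ZE; exists n, A, B.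
Qed.

(** The vertices of attachment of the bridge of [Z] that contains [x]. *)
Definition attached (Z : seq T) (x z : T) : bool :=
  (z \in Z) && [exists y in Defs.comp e [set:: Z] x, e y z].

Lemma eq_attached Z Z' x z : Z =i Z' -> attached Z x z = attached Z' x z.
Proof.
by move=> ZZ'; rewrite /attached ZZ'; have -> : [set:: Z] = [set:: Z'] by apply/setP => y; rewrite !inE.
Qed.

Lemma attached_comp Z x y z : y \in Defs.comp e [set:: Z] x ->
  attached Z y z = attached Z x z.
Proof. by rewrite /attached => /(compP e_sym) ->. Qed.

Lemma attached_adj Z x z : z \in Z -> e x z -> attached Z x z.
Proof. by move=> zZ xz; rewrite /attached zZ; apply/exists_inP; exists x => //; exact: comp_refl. Qed.

(** As [u] is no cut vertex, some path from [x] to another vertex of [Z] avoids [u]; its first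
    vertex on [Z] is an attachment. *)
Lemma attached_avoiding Z x u : 2 < size Z -> uniq Z -> x \notin Z -> u \in Z ->
  exists2 z, attached Z x z & z != u.
Proof.
move=> sZ uZ xZ uZu.
have [z0 z0Z z0u] : exists2 z, z \in Z & z != u.
  case: Z sZ uZ {xZ uZu} => // a [|b Z] //= _ /andP[]; rewrite inE negb_or => /andP[ab _] _.
  have [au|au] := eqVneq a u; last by exists a; rewrite ?mem_head.
  by exists b; rewrite ?inE ?eqxx ?orbT // -au eq_sym.
have [_ _ c1] := bi.
have xS : x \notin [set u] by rewrite inE; apply: contraNneq xZ => ->.
have z0S : z0 \notin [set u] by rewrite inE.
have [p [px lp _ pS]] := connect_path xS (c1 u _ _ xS z0S).
have hp : has (mem Z) p.
  case: p lp {px pS} => [|y p] lp; first by move: xZ; rewrite -[x]/(last x [::]) lp z0Z.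
  by apply/hasP; exists z0 => //; rewrite -lp /= mem_last.
have [q [z [p2 [pE lq zZ nq]]]] := first_hit px hp.
exists z; last first.
  by move/allP: pS => /(_ z); rewrite pE mem_cat mem_head orbT inE; exact.
rewrite /attached [z \in Z]zZ /=; apply/exists_inP; exists (last x q).
  have xZ' : x \notin [set:: Z] by rewrite inE.
  have pq : path e x q by move: lq; rewrite /link rcons_path => /andP[].
  apply: (path_comp xZ' pq); last exact: mem_last.
  by apply/allP => y /(hasPn nq) /=; rewrite inE.
by move: lq; rewrite /link rcons_path => /andP[].
Qed.

Lemma comp_path Z x y y' : x \notin Z -> y \in Defs.comp e [set:: Z] x ->
  y' \in Defs.comp e [set:: Z] x ->
  exists p, [/\ path e y p, last y p = y', uniq (y :: p) & {subset y :: p <= Defs.comp e [set:: Z] x}].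
Proof.
move=> xZ yx y'x; have xS : x \notin [set:: Z] by rewrite inE.
have yS := comp_notin xS yx.
have cyy' : connect (restr e [set:: Z]) y y' by rewrite -mem_comp (compP e_sym yx).
have [p [py lp up pS]] := connect_path yS cyy'.
by exists p; split => // w wp; rewrite -(compP e_sym yx); exact: path_comp wp.
Qed.

Lemma attached_ear Z x s t : x \notin Z -> attached Z x s -> attached Z x t ->
  exists P, [/\ link e s P t, uniq P, P != [::] & {subset P <= Defs.comp e [set:: Z] x}].
Proof.
move=> xZ /andP[_ /exists_inP[a ax eas]] /andP[_ /exists_inP[b bx ebt]].
have [p [pa lp up sub]] := comp_path xZ ax bx.
by exists (a :: p); split => //; rewrite /link /= e_sym eas rcons_path pa lp.
Qed.

(** Take an ear from [u] to [v] through the component and walk inside the component from a neighbour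
    of [w] until the ear is hit; the hit vertex is the centre. *)
Lemma attached_tripod Z x u v w : x \notin Z ->
  attached Z x u -> attached Z x v -> attached Z x w ->
  exists c P Q R, [/\ link e c P u, link e c Q v, link e c R w, uniq (c :: P ++ Q ++ R) &
    {subset c :: P ++ Q ++ R <= Defs.comp e [set:: Z] x}].
Proof.
move=> xZ /(attached_ear xZ) h /h{h}[L [lL uL L0 subL]] /andP[_ /exists_inP[a ax eaw]].
case: L L0 lL uL subL => // b L _ lL uL subL.
have bx : b \in Defs.comp e [set:: Z] x by apply: subL; rewrite mem_head.
have [p [pa lp up sub]] := comp_path xZ ax bx.
have [R [c [lR cL RL uR subR]]] : exists R c, [/\ link e c R w, c \in b :: L,
    forall z, z \in R -> z \notin b :: L, uniq R & {subset R <= Defs.comp e [set:: Z] x}].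
  have [aL|aL] := boolP (a \in b :: L); first by exists [::], a; rewrite link0.
  have hp : has (mem (b :: L)) p.
    case: p lp {pa up sub} => [|y p] lp; first by move: aL; rewrite -[a]/(last a [::]) lp mem_head.
    by apply/hasP; exists b; [rewrite -lp /= mem_last | exact: mem_head].
  have [q [c [p2 [pE lq cL nq]]]] := first_hit pa hp.
  exists (rev (a :: q)), c; split => //.
  - by rewrite link_rev // link_cons e_sym eaw.
  - by move=> z; rewrite mem_rev inE => /orP[/eqP ->//|/(hasPn nq)].
  - by rewrite rev_uniq; move: up; rewrite pE -cat_cons cat_uniq => /and3P[].
  - move=> z; rewrite mem_rev => zq; apply: sub.
    by rewrite pE -cat_cons mem_cat zq.
case: (path.splitPr cL) lL uL subL RL => L1 L2 lL uL subL RL.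
move: lL; rewrite link_cat => /andP[lL1 lL2].
exists c, (rev L1), L2, R; split => //.
- by rewrite link_rev.
- apply/uniq_countP => z; have := elimT (uniq_countP _) uL z; have := elimT (uniq_countP _) uR z.
  have [/RL|] := boolP (z \in R); rewrite -count_mem_eq0; count_lia.
- move=> z; rewrite inE !mem_cat mem_rev => /or3P[/eqP ->|zL1|/orP[zL2|zR]]; last exact: subR.
  all: by apply: subL; rewrite mem_cat inE ?zL1 ?zL2 ?eqxx ?orbT.
Qed.

Lemma comp_notin_cycle Z x y : x \notin Z -> y \in Defs.comp e [set:: Z] x -> y \notin Z.
Proof. by move=> xZ /comp_notin; rewrite !inE; apply. Qed.

Lemma attached_two Z x u v w : cycle e Z -> uniq Z -> x \notin Z ->
  attached Z x u -> attached Z x v -> attached Z x w ->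
  u != v -> w != u -> w != v -> False.
Proof.
move=> cZ uZ xZ.
(* By symmetry [w] may be assumed to follow [v] on the cycle read from [u]. *)
wlog [n [A [B [C ZE]]]] : v w / exists n A B C, rot n Z = u :: A ++ v :: B ++ w :: C.
  move=> H xu xv xw uv wu wv.
  have uZ' : u \in Z by case/andP: xu.
  have vZ : v \in Z by case/andP: xv.
  have wZ : w \in Z by case/andP: xw.
  have [n [A [B ZE]]] := split_cycle uv uZ' vZ.
  have : w \in u :: A ++ v :: B by rewrite -ZE mem_rot.
  rewrite inE (negbTE wu) /= mem_cat inE (negbTE wv) /= => /orP[wA|wB].
    case: (path.splitPr wA) ZE => A1 A2 ZE.
    apply: (H w v) => //; rewrite 1?eq_sym //.
    by exists n, A1, A2, B; rewrite ZE -catA.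
  case: (path.splitPr wB) ZE => B1 B2 ZE.
  by apply: (H v w) => //; exists n, A, B1, B2.
move=> xu xv xw _ _ _; apply: noK4.
have [c [P [Q [R [lP lQ lR un sub]]]]] := attached_tripod xZ xu xv xw.
apply: (K4_tripod e_sym _ lP lQ lR (A := A) (B := B) (C := C)).
  by rewrite -ZE rot_cycle.
rewrite -ZE cat_uniq rot_uniq uZ un andbT.
apply/hasPn => z /sub /(comp_notin_cycle xZ) zZ.
by change (z \notin rot n Z); rewrite mem_rot.
Qed.

Lemma attached_pair Z x : longest_cycle Z -> x \notin Z ->
  exists s t, [/\ s != t, s \in Z, t \in Z & forall z, attached Z x z = (z == s) || (z == t)].
Proof.
move=> [cZ uZ sZ _] xZ.
have [z0 z0Z] : exists z, z \in Z by case: (Z) sZ => // a ? _; exists a; rewrite mem_head.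
have [s xs _] := attached_avoiding sZ uZ xZ z0Z.
have [sZs _] := andP xs.
have [t xt ts] := attached_avoiding sZ uZ xZ sZs.
exists s, t; rewrite eq_sym; split => //; first by case/andP: xt.
move=> z; apply/idP/idP => [xz|/orP[]/eqP -> //].
have [//|zs] := eqVneq z s; have [//|zt] := eqVneq z t.
by case: (attached_two cZ uZ xZ xs xt xz) => //; rewrite eq_sym.
Qed.

(** Either [x] and [y] share a component, which then has three attachments, or ears through the two
    disjoint components are crossing diagonals of the cycle. *)
Lemma attached_noncrossing Z x y s s' t t' A B C D X : cycle e Z -> uniq Z ->
  x \notin Z -> y \notin Z -> Z = X ++ s :: A ++ s' :: B ++ t :: C ++ t' :: D ->
  attached Z x s -> attached Z x t -> attached Z y s' -> attached Z y t' -> False.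
Proof.
move=> cZ uZ xZ yZ ZE xs xt ys' yt'; apply: noK4.
have uZ' := elimT (uniq_countP _) uZ.
have [P [lP uP _ subP]] := attached_ear xZ xs xt.
have [Q [lQ uQ _ subQ]] := attached_ear yZ ys' yt'.
have [xy|xy] := boolP (y \in Defs.comp e [set:: Z] x).
  exfalso; rewrite (attached_comp _ xy) in ys'.
  apply: (attached_two cZ uZ xZ xs xt ys').
  - by apply/eqP => h; have := uZ' s; rewrite ZE !count_simp h eqxx; count_lia.
  - by apply/eqP => h; have := uZ' s; rewrite ZE !count_simp h eqxx; count_lia.
  - by apply/eqP => h; have := uZ' t; rewrite ZE !count_simp h eqxx; count_lia.
apply: (K4_crossing e_sym (u := s) (A := A) (x := s') (B := B) (v := t) (C := C) (y := t') (D := D ++ X) _ lP lQ).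
  by move: cZ; rewrite ZE -(rot_cycle (size X)) rot_size_cat /= -!catA /= -!catA /= -!catA.
apply/uniq_countP => z; have := uZ' z.
have := elimT (uniq_countP _) uP z; have := elimT (uniq_countP _) uQ z.
have [zP|] := boolP (z \in P).
  have := comp_notin_cycle xZ (subP _ zP).
  have : z \notin Q.
    apply: contraNN xy => /subQ /(compP e_sym) zy.
    by have := compP e_sym (subP _ zP); rewrite zy => <-; exact: comp_refl.
  by rewrite ZE -!count_mem_eq0; count_lia.
have [zQ|] := boolP (z \in Q).
  by have := comp_notin_cycle yZ (subQ _ zQ); rewrite ZE -!count_mem_eq0; count_lia.
by rewrite ZE -!count_mem_eq0; count_lia.
Qed.

End Cycles.

(** * Structure of light components *)

Section Light.
Variables (T : finType) (e : rel T).
Hypothesis e_sym : symmetric e.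
Hypothesis e_irr : irreflexive e.
Hypothesis bi : biconnected e.
Hypothesis noK4 : ~ has_K4_subdivision e.
Hypothesis nte : no_transitive_edges e.

Lemma comp_ind (S : {set T}) x (P : T -> Prop) : P x ->
  (forall y z, P y -> y \in Defs.comp e S x -> z \in Defs.comp e S x -> restr e S y z -> P z) ->
  forall y, y \in Defs.comp e S x -> P y.
Proof.
move=> Px step y; rewrite mem_comp => /connectP[p].
elim/last_ind: p y => [|p z IH] y /=; first by move=> _ ->.
rewrite rcons_path last_rcons => /andP[px lz] ->.
have lp : last x p \in Defs.comp e S x by rewrite mem_comp; apply/connectP; exists p.
apply: (step (last x p)) => //; first exact: IH.
by rewrite mem_comp; apply: (connect_trans _ (connect1 lz)); rewrite -mem_comp.
Qed.

(** A component of [G - Z] can be left only through its attachments, so deleting these two already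
    isolates it. *)
Lemma comp_attached (Z : seq T) x s t : x \notin Z -> s \in Z -> t \in Z ->
  (forall z, attached e Z x z = (z == s) || (z == t)) ->
  Defs.comp e [set s; t] x = Defs.comp e [set:: Z] x.
Proof.
move=> xZ sZ tZ att; apply/eqP; rewrite eqEsubset; apply/andP; split; apply/subsetP.
  apply: comp_ind => [|y z yx _ _]; first exact: comp_refl.
  rewrite /restr !inE !negb_or => /and3P[/andP[ys yt] /andP[zs zt] yz].
  have yZ := comp_notin_cycle xZ yx.
  rewrite -mem_comp; apply: (comp_step yx yz); rewrite inE //.
  apply/negP => zZ; have := att z; rewrite (negbTE zs) (negbTE zt).
  by rewrite -(attached_comp e_sym _ yx) attached_adj.
move=> y; rewrite !mem_comp; apply: connect_sub => a b.
rewrite /restr !inE => /and3P[aZ bZ ab]; apply: connect1.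
rewrite !inE !negb_or ab andbT -andbA; apply/and4P; split.
- by apply: contraNneq aZ => ->.
- by apply: contraNneq aZ => ->.
- by apply: contraNneq bZ => ->.
- by apply: contraNneq bZ => ->.
Qed.

Section OuterArc.
(* [B] closes every [s]-[t] path through the component of [x] into a cycle. *)
Variables (s t x : T) (B : seq T).
Hypothesis st : s != t.
Hypothesis lB : link e t B s.
Hypothesis unB : uniq (s :: t :: B).
Hypothesis xS : x \notin [set s; t].
Let C := Defs.comp e [set s; t] x.
Hypothesis BC : forall z, z \in B -> z \notin C.

Lemma ear_uniq P : uniq P -> {subset P <= C} -> uniq (s :: P ++ t :: B).
Proof.
move=> /uniq_countP uP PC; apply/uniq_countP => z.
have := uP z; have := elimT (uniq_countP _) unB z.
have [/PC zC|] := boolP (z \in P); last by rewrite -count_mem_eq0; count_lia.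
have : z \notin B by apply/negP => /BC; rewrite zC.
have := comp_notin xS zC; rewrite !inE !(eq_sym z) -count_mem_eq0; count_lia.
Qed.

Lemma ear_chord_s A y D : link e s (A ++ y :: D) t -> uniq (A ++ y :: D) ->
  {subset A ++ y :: D <= C} -> A != [::] -> ~~ e s y.
Proof.
move=> lP uP sub; apply: (chordless_ear e_sym e_irr noK4 nte lP lB).
exact: ear_uniq.
Qed.

Lemma ear_chord_t A y D : link e s (A ++ y :: D) t -> uniq (A ++ y :: D) ->
  {subset A ++ y :: D <= C} -> D != [::] -> ~~ e t y.
Proof.
move=> lP uP sub; apply: (chordless_ear_rev e_sym e_irr noK4 nte lP lB).
exact: ear_uniq.
Qed.

Hypothesis light : forall y, y \in C -> e s y || e t y.

(** A neighbour [b] of [y] in the component is adjacent to [s] or [t]; then the ear s, b, y, t has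
    the chord [s y], or the ear s, y, b, t the chord [t y]. *)
Lemma tie_alone y y' : y \in C -> e s y -> e t y -> y' \in C -> y' = y.
Proof.
move=> yC sy ty; rewrite /C -(compP e_sym yC); move: y'.
apply: comp_ind => // a b -> _ bC; rewrite /restr => /and3P[yS bS yb].
rewrite (compP e_sym yC) -/C in bC.
have by' : b != y by apply: contraTneq yb => ->; rewrite e_irr.
have subC a' b' : a' \in C -> b' \in C -> {subset [:: a'; b'] <= C}.
  by move=> ha hb z; rewrite in_cons mem_seq1 => /orP[]/eqP ->.
have [sb|tb] := orP (light bC).
  have : ~~ e s y.
    apply: (@ear_chord_s [:: b] y [::]) => /=; last by [].
    + by rewrite /link /= sb e_sym yb e_sym ty.
    + by rewrite inE by'.
    + exact: subC.
  by rewrite sy.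
have : ~~ e t y.
  apply: (@ear_chord_t [::] y [:: b]) => /=; last by [].
  + by rewrite /link /= sy yb e_sym tb.
  + by rewrite inE eq_sym by'.
  + exact: subC.
by rewrite ty.
Qed.

(** On an ear through [y], the vertex [y] must come first and [y'] cannot come later, as [s y] or
    [s y'] would be a chord. Then [y'] can be inserted before [y], which makes [s y] a chord. *)
Lemma arm_indep y y' : y \in C -> y' \in C -> e s y -> e s y' -> ~~ e y y'.
Proof.
move=> yC y'C sy sy'; apply/negP => yy'.
have ne : y != y' by apply: contraTneq yy' => ->; rewrite e_irr.
have yS := comp_notin xS yC.
have [P [lP un yP sub]] := ear_through e_sym e_irr bi st yS.
rewrite (compP e_sym yC) -/C in sub.
case: (path.splitPr yP) lP un sub => P1 P2 lP un sub.
have {}un : uniq (P1 ++ y :: P2).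
  by move: un; rewrite cons_uniq rcons_uniq => /and3P[].
case: P1 lP un sub => [|p P1] lP un sub; last first.
  by have := ear_chord_s lP un sub isT; rewrite sy.
rewrite /= in lP un sub.
have [y'P2|y'P2] := boolP (y' \in P2).
  case: (path.splitPr y'P2) lP un sub => P3 P4 lP un sub.
  by have := @ear_chord_s (y :: P3) y' P4 lP un sub isT; rewrite sy'.
have : ~~ e s y.
  apply: (@ear_chord_s [:: y'] y P2) => //=.
  - by move: lP; rewrite /link /= sy' (e_sym y') yy' => /andP[].
  - by rewrite inE negb_or eq_sym ne y'P2.
  - by move=> z; rewrite inE => /orP[/eqP ->//|]; exact: sub.
by rewrite sy.
Qed.

End OuterArc.

Section ReversedOuterArc.
Variables (s t x : T) (B : seq T).
Hypothesis st : s != t.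
Hypothesis lB : link e t B s.
Hypothesis unB : uniq (s :: t :: B).
Hypothesis xS : x \notin [set s; t].
Let C := Defs.comp e [set s; t] x.
Hypothesis BC : forall z, z \in B -> z \notin C.
Hypothesis light : forall y, y \in C -> e s y || e t y.

Lemma arm_indep_t y y' : y \in C -> y' \in C -> e t y -> e t y' -> ~~ e y y'.
Proof.
move=> yC y'C; have CE : C = Defs.comp e [set t; s] x by rewrite setUC.
apply: (@arm_indep t s x (rev B)); rewrite -?CE //.
- by rewrite eq_sym.
- by rewrite link_rev.
- by apply/uniq_countP => z; have := elimT (uniq_countP _) unB z; count_lia.
- by rewrite setUC.
- by move=> z; rewrite mem_rev; exact: BC.
Qed.

(** The component is explored from [a], with an invariant that ties every vertex met to [a] by a
    short path. *)
Lemma arms_complete a b : a \in C -> b \in C -> e s a -> ~~ e t a -> e t b -> ~~ e s b -> e a b.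
Proof.
move=> aC bC sa ta tb sb.
(* Neighbours of [t] are adjacent to [a]; neighbours of [s] other than [a] share with [a] a
   neighbour [b'] that is adjacent to [t]. *)
pose inv y := (e t y -> e a y) /\ (e s y -> y = a \/ exists b', [/\ b' \in C, e t b', e a b' & e b' y]).
have [] // : inv b; last by move=> /(_ tb).
move: bC; rewrite /C -(compP e_sym aC); move: b {tb sb}.
apply: comp_ind.
  by split; [rewrite (negbTE ta) | left].
move=> y y'; rewrite (compP e_sym aC) -/C => -[iy1 iy2] yC y'C /and3P[_ _ yy'].
split => [ty'|sy'].
  have ty : ~~ e t y by apply: contraTN yy' => ty; exact: arm_indep_t.
  have sy : e s y by move: (light yC); rewrite (negbTE ty) orbF.
  case: (iy2 sy) => [<- //|[b' [b'C tb' ab' b'y]]].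
  have [<- //|b'y'] := eqVneq b' y'.
  have [ya|ya] := eqVneq y a; first by rewrite -ya.
  exfalso; apply: noK4.
  have nsb c : c \in C -> e t c -> c != a.
    by move=> _ tc; apply: contraNneq ta => <-.
  have sy'n z : z \in C -> e t z -> z != y by move=> _ tz; apply: contraNneq ty => <-.
  (* The centre [b'] is joined to [y] and [t] directly and to [s] through [a]; the cycle is s, y,
     y', t followed by [B]. *)
  apply: (K4_tripod e_sym (u := s) (A := [::]) (v := y) (B := [:: y']) (w := t) (C := B) (c := b')
    (P := [:: a]) (Q := [::]) (R := [::])).
  - by rewrite /= sy yy' (e_sym y') ty'; exact: lB.
  - by rewrite /link /= e_sym ab' e_sym sa.
  - by rewrite link0.
  - by rewrite link0 e_sym.
  have yy'n : y != y' by apply: contraTneq yy' => ->; rewrite e_irr.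
  have un4 : uniq [:: y; y'; b'; a].
    rewrite /= !inE !negb_or (eq_sym y b') (eq_sym y' b').
    by rewrite yy'n sy'n // ya b'y' !nsb.
  rewrite (perm_uniq (_ : perm_eq _ ((s :: t :: B) ++ [:: y; y'; b'; a]))); last first.
    by apply/permP => z; count_lia.
  rewrite cat_uniq unB un4 andbT; apply/hasPn => z z4.
  have zC : z \in C by move: z4; rewrite 3!in_cons mem_seq1 => /or4P[]/eqP ->.
  apply/negP; rewrite 2!in_cons orbA => /orP[zst|/BC]; last by rewrite zC.
  by have := comp_notin xS zC; rewrite in_set2 zst.
have sy : ~~ e s y by apply: contraTN yy' => sy; exact: (arm_indep st lB unB xS BC).
have ty : e t y by move: (light yC); rewrite (negbTE sy).
by right; exists y; split => //; exact: iy1.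
Qed.
End ReversedOuterArc.
End Light.

(** * The components of [G - Z] are light *)

Section Bridges.
Variables (T : finType) (e : rel T).
Hypothesis e_sym : symmetric e.
Hypothesis e_irr : irreflexive e.
Hypothesis bi : biconnected e.
Hypothesis noK4 : ~ has_K4_subdivision e.
Hypothesis nte : no_transitive_edges e.
Hypothesis heavy2 : at_most_2_heavy e.

(** With three or more inner vertices, the second one would be the end of a chord from [s] or
    [t]. *)
Lemma arc_short s t A B : link e s A t -> link e t B s -> uniq (s :: A ++ t :: B) ->
  (forall a, a \in A -> e s a || e t a) -> size A <= 2.
Proof.
move=> lA lB un adj; case: A lA un adj => [|a1 [|a2 [|a3 A]]] // lA un adj.
have := adj a2; rewrite !inE eqxx orbT => /(_ isT) /orP[sa|ta].
  have := @chordless_ear _ _ e_sym e_irr noK4 nte s t [:: a1] a2 (a3 :: A) B lA lB un isT.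
  by rewrite sa.
have := @chordless_ear_rev _ _ e_sym e_irr noK4 nte s t [:: a1] a2 (a3 :: A) B lA lB un isT.
by rewrite ta.
Qed.

Lemma attached_arc Z x s t : longest_cycle e Z -> x \notin Z -> s != t -> s \in Z -> t \in Z ->
  (forall z, attached e Z x z = (z == s) || (z == t)) ->
  exists n A B, [/\ rot n Z = s :: A ++ t :: B, link e s A t, link e t B s & uniq (s :: A ++ t :: B)].
Proof.
move=> [cZ uZ sZ _] xZ st sZs tZ att.
have [n [A [B ZE]]] := split_cycle st sZs tZ; exists n, A, B.
have : cycle e (rot n Z) by rewrite rot_cycle.
by rewrite ZE cycle_link link_cat -ZE rot_uniq => /andP[].
Qed.

(** A path between the two arcs that avoids [s] and [t] would cross an ear through the component of
    [x]. *)
Lemma cross_arc Z x s t n A B a b : longest_cycle e Z -> x \notin Z -> s != t ->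
  (forall z, attached e Z x z = (z == s) || (z == t)) ->
  rot n Z = s :: A ++ t :: B -> a \in A -> b \in B ->
  b \notin Defs.comp e [set s; t] a.
Proof.
move=> LZ xZ st att ZE aA bB; apply/negP; rewrite mem_comp => cab; apply: noK4.
have [cZ uZ sZ _] := LZ.
have xs : attached e Z x s by rewrite att eqxx.
have xt : attached e Z x t by rewrite att eqxx orbT.
have cZ' : cycle e (s :: A ++ t :: B) by rewrite -ZE rot_cycle.
have uZ' : uniq (s :: A ++ t :: B) by rewrite -ZE rot_uniq.
have memZ z : (z \in Z) = (z \in s :: A ++ t :: B) by rewrite -ZE mem_rot.
have un := elimT (uniq_countP _) uZ'.
have aS : a \notin [set s; t].
  by rewrite in_set2 !(eq_sym a); move: aA; rewrite -count_mem_gt0; have := un a; count_lia.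
have AB z : z \in A -> z \notin B.
  by rewrite -count_mem_gt0 -count_mem_eq0; have := un z; count_lia.
have [a' [q [b' [a'A b'B lq uq hq]]]] := link_between e_sym aS cab aA bB AB.
have [P [lP uP _ subP]] := attached_ear e_sym xZ xs xt.
have qZ z : z \in q -> z \notin Z.
  move=> /hq[]; rewrite in_set2 memZ in_cons mem_cat in_cons !negb_or.
  by move=> /andP[-> ->] -> ->.
(* A common vertex would make [a'] a third attachment of the component of [x]. *)
have Pq z : z \in P -> z \notin q.
  move=> zP; apply/negP => zq.
  have zC := subP _ zP.
  have : attached e Z x a'.
    rewrite -(attached_comp e_sym _ zC).
    case: q lq uq hq qZ zq => // q0 q; rewrite link_cons => /andP[a'q0 lq] uq hq qZ zq.
    have pq : path e q0 q by move: lq; rewrite /link rcons_path => /andP[].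
    have : z \in Defs.comp e [set:: Z] q0.
      apply: (path_comp _ pq) => //.
        by rewrite inE; apply: qZ; rewrite mem_head.
      by apply/allP => w wq; rewrite inE; apply: qZ; rewrite in_cons wq orbT.
    move=> zq0; rewrite (attached_comp e_sym _ zq0); apply: attached_adj; last by rewrite e_sym.
    by rewrite memZ in_cons mem_cat a'A orbT.
  rewrite att => a'st.
  move: a'st a'A; rewrite !(eq_sym a') -count_mem_gt0; have := un a'; count_lia.
case: (path.splitPr a'A) cZ' uZ' un memZ => A1 A2 cZ' uZ' un memZ.
case: (path.splitPr b'B) cZ' uZ' un memZ => B1 B2 cZ' uZ' un memZ.
apply: (@K4_crossing _ _ e_sym s A1 a' A2 t B1 b' B2 P q) => //.
  by move: cZ'; rewrite -catA.
apply/uniq_countP => z; have := un z.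
have := elimT (uniq_countP _) uP z; have := elimT (uniq_countP _) uq z.
have [zP|] := boolP (z \in P).
  have := comp_notin_cycle xZ (subP _ zP); have := Pq z zP.
  by rewrite memZ -!count_mem_eq0; count_lia.
have [zQ|] := boolP (z \in q).
  by have := qZ z zQ; rewrite memZ -!count_mem_eq0; count_lia.
by rewrite -!count_mem_eq0; count_lia.
Qed.

Lemma path_inner_comp (S : {set T}) A a b : path e a A -> all (fun z => z \notin S) (a :: A) ->
  b \in a :: A -> b \in Defs.comp e S a.
Proof. by move=> pA /= /andP[aS AS] bA; exact: path_comp bA. Qed.

(* Otherwise the component is heavy; either both arcs of Z lie in further heavy components,
   or some arc has at most two inner vertices and can be replaced by a longer path through x. *)
Lemma bridge_light_one Z x s t : longest_cycle e Z -> x \notin Z -> s != t -> s \in Z -> t \in Z ->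
  (forall z, attached e Z x z = (z == s) || (z == t)) -> e s x || e t x.
Proof.
move=> LZ xZ st sZ tZ att.
have [n [A [B [ZE lA lB uAB]]]] := attached_arc LZ xZ st sZ tZ att.
have CE := comp_attached e_sym xZ sZ tZ att.
apply: contraT; rewrite negb_or => /andP[sx tx].
have xS : x \notin [set s; t].
  by rewrite in_set2; apply/negP => /orP[]/eqP xx; move: xZ; rewrite xx ?sZ ?tZ.
have memZ z : (z \in Z) = (z \in s :: A ++ t :: B) by rewrite -ZE mem_rot.
have un := elimT (uniq_countP _) uAB.
have [P [lP uP xP subP]] := ear_through e_sym e_irr bi st xS.
have PZ z : z \in P -> z \notin Z.
  by move=> /subP; rewrite CE => /(comp_notin_cycle xZ).
(* As [x] is adjacent to neither end, the ear has an inner vertex on each side of it. *)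
have P3 : 2 < size P.
  case: (path.splitPr xP) lP => P1 P2; rewrite link_cat => /andP[l1 l2].
  case: P1 l1 => [|p1 P1] l1; first by move: sx; rewrite -link0 l1.
  case: P2 l2 => [|p2 P2] l2; first by move: tx; rewrite e_sym -link0 l2.
  by rewrite size_cat /= !addnS addSn.
have uP' : uniq P by move: uP; rewrite cons_uniq rcons_uniq => /and3P[].
(* Replacing an arc with at most two inner vertices by [P] would lengthen the longest cycle. *)
have lPB (D E : seq T) : link e s D t -> link e t E s -> uniq (s :: D ++ t :: E) ->
    (forall z, z \in s :: t :: E -> z \in Z) -> size Z = (size D + size E).+2 -> 2 < size D.
  move=> lD lE uDE EZ sizeZ; have [_ _ _ mx] := LZ.
  rewrite ltnNge; apply/negP => D2.
  have := mx (s :: P ++ t :: E); rewrite cycle_link link_cat lP lE => /(_ isT).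
  rewrite /= size_cat /= sizeZ addnS => h.
  suff /h : uniq (s :: P ++ t :: E) by move: P3 D2; clear; lia.
  apply/uniq_countP => z; have := elimT (uniq_countP _) uDE z.
  have := elimT (uniq_countP _) uP' z.
  have [/PZ|] := boolP (z \in P); last by rewrite -count_mem_eq0; count_lia.
  move=> zZ; have : z \notin s :: t :: E by apply: contraNN zZ; exact: EZ.
  by rewrite -count_mem_eq0; count_lia.
have sizeZ : size Z = (size A + size B).+2 by rewrite -(size_rot n) ZE /= size_cat /= addnS.
have A3 : 2 < size A.
  apply: (lPB A B) => // z; rewrite memZ !in_cons mem_cat in_cons.
  by case: (z == s) (z == t) (z \in A) (z \in B) => [] [] [] [].
have B3 : 2 < size B.
  rewrite -size_rev; apply: (lPB (rev B) (rev A)); rewrite ?link_rev //.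
  - by apply/uniq_countP => z; have := un z; count_lia.
  - move=> z; rewrite memZ !in_cons mem_cat in_cons mem_rev.
    by case: (z == s) (z == t) (z \in A) (z \in B) => [] [] [] [].
  - by rewrite !size_rev addnC.
have inS z : z \in A ++ B -> z \notin [set s; t].
  rewrite in_set2 !(eq_sym z) -count_mem_gt0; have := un z; count_lia.
(* The whole arc lies in the component of its first vertex; were that component light, [arc_short]
   would contradict [A3]. *)
have heavyA : exists2 a, a \in Defs.comp e [set s; t] (head s A) & ~~ e s a && ~~ e t a.
  apply/exists_inP; apply: contraTT A3; rewrite negb_exists_in => /forall_inP h.
  rewrite -leqNgt; apply: (arc_short lA lB uAB) => a aA.
  have /h : a \in Defs.comp e [set s; t] (head s A).
    case: (A) aA lA inS => // a0 A' aA lA inS.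
    apply: (path_inner_comp (A := A')) => //.
      by move: lA; rewrite link_cons /link rcons_path => /and3P[].
    by apply/allP => z zA; apply: inS; rewrite mem_cat zA.
  by rewrite negb_and !negbK.
have heavyB : exists2 b, b \in Defs.comp e [set s; t] (head s B) & ~~ e s b && ~~ e t b.
  apply/exists_inP; apply: contraTT B3; rewrite negb_exists_in => /forall_inP h.
  rewrite -leqNgt -size_rev; apply: (@arc_short s t (rev B) (rev A)); rewrite ?link_rev //.
    by apply/uniq_countP => z; have := un z; count_lia.
  move=> b; rewrite mem_rev => bB.
  have /h : b \in Defs.comp e [set s; t] (head s B).
    case: (B) bB lB inS => // b0 B' bB lB inS.
    apply: (path_inner_comp (A := B')) => //.
      by move: lB; rewrite link_cons /link rcons_path => /and3P[].
    by apply/allP => z zA; apply: inS; rewrite mem_cat zA orbT.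
  by rewrite negb_and !negbK.
have [a aC na] := heavyA; have [b bC nb] := heavyB.
have hA : head s A \in A by case: (A) A3 => // ? ? _; exact: mem_head.
have hB : head s B \in B by case: (B) B3 => // ? ? _; exact: mem_head.
have aS : a \notin [set s; t] by apply: (comp_notin _ aC); apply: inS; rewrite mem_cat hA.
have bS : b \notin [set s; t] by apply: (comp_notin _ bC); apply: inS; rewrite mem_cat hB orbT.
have inheavy y : y \notin [set s; t] -> ~~ e s y && ~~ e t y ->
    Defs.comp e [set s; t] y \in heavy_components e s t.
  by move=> yS ny; apply/imsetP; exists y => //; rewrite inE yS.
have nAx : head s A \notin Defs.comp e [set s; t] x.
  rewrite CE; apply/negP => /(comp_notin_cycle xZ).
  by rewrite memZ in_cons mem_cat hA orbT.
have nBx : head s B \notin Defs.comp e [set s; t] x.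
  rewrite CE; apply/negP => /(comp_notin_cycle xZ).
  by rewrite memZ in_cons mem_cat in_cons hB !orbT.
have sep : separation_pair e s t.
  split => // /(_ x (head s A) xS); rewrite -mem_comp (negbTE nAx) => h.
  by have := h (inS _ _); rewrite mem_cat hA => /(_ isT).
have := heavy2 sep; rewrite leqNgt => /negP[].
apply/card_gt2P; exists (Defs.comp e [set s; t] x), (Defs.comp e [set s; t] a), (Defs.comp e [set s; t] b).
split; first by split; apply: inheavy; rewrite ?sx.
have hd y y' z : y \in Defs.comp e [set s; t] z -> Defs.comp e [set s; t] y' = Defs.comp e [set s; t] y ->
    y' \in Defs.comp e [set s; t] z.
  by move=> yz yy'; rewrite -(compP e_sym yz) -yy' comp_refl.
split.
- apply/eqP => xa; case/negP: nAx; rewrite xa (compP e_sym aC); exact: comp_refl.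
- apply/eqP => ab; have := cross_arc LZ xZ st att ZE hA hB; case/negP.
  by rewrite -(compP e_sym aC) ab (compP e_sym bC); exact: comp_refl.
- apply/eqP => bx; case/negP: nBx; rewrite -bx (compP e_sym bC); exact: comp_refl.
Qed.

End Bridges.

(** * Order along the cycle, and a cycle vertex free of attachments *)

Lemma split_index (T : eqType) (Z : seq T) b : b \in Z ->
  exists P D, Z = P ++ b :: D /\
    forall a, index a Z < index b Z -> a \in P /\ index a P = index a Z.
Proof.
move=> bZ; exists (take (index b Z) Z), (drop (index b Z).+1 Z).
have ib : index b Z < size Z by rewrite index_mem.
have ZE : Z = take (index b Z) Z ++ b :: drop (index b Z).+1 Z.
  by rewrite -[in LHS](cat_take_drop (index b Z) Z) (drop_nth b ib) nth_index.
split=> // a; rewrite {1}ZE index_cat; case: ifP => [aP _|_]; last first.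
  by rewrite size_take ib; lia.
by split => //; rewrite [in RHS]ZE index_cat aP.
Qed.

Lemma index_split2 (T : eqType) (Z : seq T) a b : b \in Z -> index a Z < index b Z ->
  exists X A D, Z = X ++ a :: A ++ b :: D.
Proof.
move=> bZ ab; have [P [D [ZE h]]] := split_index bZ.
have [aP _] := h a ab; case: (path.splitPr aP) ZE => X A ZE.
by exists X, A, D; rewrite ZE -catA.
Qed.

Lemma index_split4 (T : eqType) (Z : seq T) a b c d : d \in Z ->
  index a Z < index b Z -> index b Z < index c Z -> index c Z < index d Z ->
  exists X A B C D, Z = X ++ a :: A ++ b :: B ++ c :: C ++ d :: D.
Proof.
move=> dZ ab bc cd; have [P [D [ZE h]]] := split_index dZ.
have [cP ic] := h c cd; have [bP ib] := h b (ltn_trans bc cd).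
have [aP ia] := h a (ltn_trans ab (ltn_trans bc cd)).
have [Q [C [PE h']]] := split_index cP.
rewrite -ic -ib in bc; rewrite -ib -ia in ab.
have [bQ ib'] := h' b bc; have [aQ ia'] := h' a (ltn_trans ab bc).
rewrite -ib' -ia' in ab.
have [X [A [B QE]]] := index_split2 bQ ab.
by exists X, A, B, C, D; rewrite ZE PE QE -!catA /= -!catA.
Qed.

Section FreeCycle.
Variables (T : finType) (e : rel T).
Hypothesis e_sym : symmetric e.
Hypothesis e_irr : irreflexive e.
Hypothesis bi : biconnected e.
Hypothesis noK4 : ~ has_K4_subdivision e.
Hypothesis nte : no_transitive_edges e.
Hypothesis heavy2 : at_most_2_heavy e.

Lemma attached_mem Z x z : attached e Z x z -> z \in Z.
Proof. by case/andP. Qed.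

(** An end [t'] outside the span of [s] and [t], on either side, gives an order that
    [attached_noncrossing] excludes. *)
Lemma attached_nested Z x y s t s' t' : longest_cycle e Z -> x \notin Z -> y \notin Z ->
  attached e Z x s -> attached e Z x t -> attached e Z y s' -> attached e Z y t' ->
  index s Z < index s' Z -> index s' Z < index t Z ->
  index s Z <= index t' Z <= index t Z.
Proof.
move=> [cZ uZ _ _] xZ yZ xs xt ys' yt' h1 h2.
rewrite leqNgt [X in _ && X]leqNgt -negb_or; apply/negP => /orP[h3|h3].
  have [X [A [B [C [D ZE]]]]] := index_split4 (attached_mem xt) h3 h1 h2.
  exact: (attached_noncrossing e_sym noK4 cZ uZ yZ xZ ZE yt' ys' xs xt).
have [X [A [B [C [D ZE]]]]] := index_split4 (attached_mem yt') h1 h2 h3.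
exact: (attached_noncrossing e_sym noK4 cZ uZ xZ yZ ZE xs xt ys' yt').
Qed.

(** As [Z] has at least three vertices, one of its arcs has an inner vertex; with an ear through the
    component it forms a cycle on which [s t] would be a chord. *)
Lemma attached_nonadj Z x s t : longest_cycle e Z -> x \notin Z -> s != t ->
  (forall z, attached e Z x z = (z == s) || (z == t)) -> ~~ e s t.
Proof.
move=> LZ xZ st att; have [cZ uZ sizeZ _] := LZ.
have xs : attached e Z x s by rewrite att eqxx.
have xt : attached e Z x t by rewrite att eqxx orbT.
have [n [A [B [ZE lA lB uAB]]]] := attached_arc LZ xZ st (attached_mem xs) (attached_mem xt) att.
have [P [lP uP P0 subP]] := attached_ear e_sym xZ xs xt.
have memZ z : (z \in Z) = (z \in s :: A ++ t :: B) by rewrite -ZE mem_rot.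
have main E : link e t E s -> {subset E <= Z} -> uniq (s :: t :: E) -> E != [::] -> ~~ e s t.
  move=> lE EZ uE E0; apply: (chordless e_sym e_irr noK4 nte lP lE) => //.
  apply/uniq_countP => z; have := elimT (uniq_countP _) uE z.
  have := elimT (uniq_countP _) uP z.
  have [/subP/(comp_notin_cycle xZ) zZ|] := boolP (z \in P); last by rewrite -count_mem_eq0; count_lia.
  have zE : z \notin E by apply: contraNN zZ; exact: EZ.
  by move: zZ zE; rewrite memZ -!count_mem_eq0; count_lia.
have [B0|B0] := eqVneq B [::]; last first.
  apply: (main B) => //.
    by move=> z zB; rewrite memZ in_cons mem_cat in_cons zB !orbT.
  by apply/uniq_countP => z; have := elimT (uniq_countP _) uAB z; count_lia.
apply: (main (rev A)); rewrite ?link_rev //.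
- by move=> z; rewrite mem_rev memZ in_cons mem_cat => ->; rewrite orbT.
- by apply/uniq_countP => z; have := elimT (uniq_countP _) uAB z; count_lia.
- have : 2 < size (rot n Z) by rewrite size_rot.
  by rewrite ZE B0; case: (A) => // a A' _; rewrite rev_cons; case: (rev A').
Qed.

(** Having no chord, [Z] is an induced cycle; the second alternative is its closing edge. *)
Lemma cycle_edge Z s t : cycle e Z -> uniq Z -> s \in Z -> t \in Z -> index s Z < index t Z ->
  e s t = (index t Z == (index s Z).+1) || (index s Z == 0) && ((index t Z).+1 == size Z).
Proof.
move=> cZ uZ sZ tZ st; have [X [A [B ZE]]] := index_split2 tZ st.
have un := elimT (uniq_countP _) uZ.
have sX : s \notin X by rewrite -count_mem_eq0; have := un s; rewrite ZE !count_simp eqxx; count_lia.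
have tX : t \notin X by rewrite -count_mem_eq0; have := un t; rewrite ZE !count_simp eqxx; count_lia.
have tA : t \notin A by rewrite -count_mem_eq0; have := un t; rewrite ZE !count_simp eqxx; count_lia.
have ts : (s == t) = false by apply/negbTE; apply: contraTneq st => ->; rewrite ltnn.
have si : index s Z = size X by rewrite ZE index_cat (negbTE sX) /= eqxx addn0.
have ti : index t Z = size X + (size A).+1.
  by rewrite ZE index_cat (negbTE tX) /= ts index_cat (negbTE tA) /= eqxx addn0.
have cZ' : cycle e (s :: A ++ t :: (B ++ X)).
  by move: cZ; rewrite ZE -(rot_cycle (size X)) rot_size_cat /= -!catA.
have uZ' : uniq (s :: A ++ t :: (B ++ X)).
  by apply/uniq_countP => z; have := un z; rewrite ZE; count_lia.
move: cZ'; rewrite cycle_link link_cat => /andP[lA lB].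
rewrite si ti ZE size_cat /= size_cat /=.
apply/idP/idP => [est|].
  have [->|A0] := eqVneq A [::]; first by rewrite addn1 eqxx.
  have [BX|BX] := eqVneq (B ++ X) [::].
    have : size (B ++ X) = 0 by rewrite BX.
    rewrite size_cat => /eqP; rewrite addn_eq0 => /andP[/eqP -> /eqP ->].
    by rewrite !add0n eqxx addn1 eqxx orbT.
  by have := chordless e_sym e_irr noK4 nte lA lB uZ' A0 BX; rewrite est.
move=> h; have : (size A == 0) || (size (B ++ X) == 0).
  by move: h; rewrite size_cat; move: (size A) (size B) (size X); clear; lia.
case/orP => /eqP h'.
  by move: lA; rewrite (size0nil h') link0.
by move: lB; rewrite (size0nil h') link0 e_sym.
Qed.

(* [w] is the successor of the left end of a shortest attached pair. *)
Lemma exists_free_cycle : exists Y w, longest_cycle e (rcons Y w) /\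
  forall x, x \notin rcons Y w -> ~~ attached e (rcons Y w) x w.
Proof.
have [Z LZ] := exists_longest_cycle e_sym e_irr bi.
have [cZ uZ sZ _] := LZ.
(* Rotating the cycle moves [w] to the last position. *)
suff [w wZ hw] : exists2 w, w \in Z & forall x, x \notin Z -> ~~ attached e Z x w.
  case: (path.splitPr wZ) LZ hw => P D LZ hw.
  have LZ' : longest_cycle e (rcons (D ++ P) w).
    by rewrite -cats1 -catA; apply: longest_cycle_catC; rewrite -catA.
  exists (D ++ P), w; split => // x xZ.
  have memE : P ++ w :: D =i rcons (D ++ P) w.
    by move=> z; rewrite mem_rcons in_cons !mem_cat in_cons orbCA [X in _ || X]orbC.
  by rewrite -(eq_attached _ _ _ memE) hw // memE.
(* [d] is the distance, in positions on [Z], between two attachments of one component; it will be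
   minimized. *)
pose bad d := [exists x, exists s, exists t, [&& x \notin Z, attached e Z x s, attached e Z x t,
  index s Z < index t Z & index t Z - index s Z == d]].
have badI x s t : x \notin Z -> attached e Z x s -> attached e Z x t ->
    index s Z < index t Z -> bad (index t Z - index s Z).
  move=> xZ xs xt st; apply/existsP; exists x; apply/existsP; exists s; apply/existsP; exists t.
  by rewrite xZ xs xt st eqxx.
have badP x u : x \notin Z -> attached e Z x u -> exists2 v, attached e Z x v & v != u.
  by move=> xZ xu; apply: (attached_avoiding bi sZ uZ xZ (attached_mem xu)).
have idx u v : u \in Z -> v \in Z -> u != v -> index u Z != index v Z.
  by move=> uZ' vZ; apply: contraNneq => h; rewrite -(nth_index u uZ') h nth_index.
have [/existsP[x xZ]|] := boolP [exists x, x \notin Z]; last first.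
  rewrite negb_exists => /forallP h; case: (Z) sZ h => // w Z' _ h.
  by exists w; rewrite ?mem_head // => x; rewrite (negbTE (h x)).
have exbad : exists d, bad d.
  have [s [t [st sZs tZ att]]] := attached_pair e_sym bi noK4 LZ xZ.
  have xs : attached e Z x s by rewrite att eqxx.
  have xt : attached e Z x t by rewrite att eqxx orbT.
  have := idx _ _ sZs tZ st; rewrite neq_ltn => /orP[h|h].
    by exists (index t Z - index s Z); exact: badI xs xt h.
  by exists (index s Z - index t Z); exact: badI xt xs h.
have [d /existsP[y /existsP[s /existsP[t /and5P[yZ ys yt st /eqP dE]]]] mind] := ex_minnP exbad.
have {x xZ} tZ := attached_mem yt; have sZs := attached_mem ys.
have iw : (index s Z).+1 < size Z by apply: leq_ltn_trans st _; rewrite index_mem.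
pose w := nth s Z (index s Z).+1.
have wi : index w Z = (index s Z).+1 by rewrite index_uniq.
have wZ : w \in Z by rewrite mem_nth.
exists w => // x xZ; apply/negP => xw.
have st' : s != t by apply: contraTneq st => ->; rewrite ltnn.
have att : forall z, attached e Z y z = (z == s) || (z == t).
  move=> z; apply/idP/idP => [yz|/orP[]/eqP -> //].
  have [//|zs] := eqVneq z s; have [//|zt] := eqVneq z t.
  by case: (attached_two e_sym noK4 cZ uZ yZ ys yt yz).
(* [t] is not the successor of [s], because attachments of one component are nonadjacent. *)
have wt : index w Z < index t Z.
  rewrite wi ltn_neqAle st andbT; apply: contraNneq (attached_nonadj LZ yZ st' att) => h.
  by rewrite (cycle_edge cZ uZ sZs tZ st) -h eqxx.
have [v xv vw] := badP x w xZ xw.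
(* A second attachment [v] of the component at [w] stays between [s] and [t], so [v] and [w] are
   closer than the minimum. *)
have := attached_nested LZ yZ xZ ys yt xw xv; rewrite wi ltnSn -wi => /(_ isT wt) /andP[h1 h2].
have := idx _ _ (attached_mem xv) wZ vw; rewrite neq_ltn => /orP[h|h].
  have := mind _ (badI _ _ _ xZ xv xw h); move: dE h h1 h2 wi wt.
  by move: (index v Z) (index w Z) (index s Z) (index t Z); clear; lia.
have := mind _ (badI _ _ _ xZ xw xv h); move: dE h h1 h2 wi wt.
by move: (index v Z) (index w Z) (index s Z) (index t Z); clear; lia.
Qed.

End FreeCycle.

(** * From the graph to a layout *)

Section LayoutOfGraph.
Variables (T : finType) (e : rel T).
Hypothesis e_sym : symmetric e.
Hypothesis e_irr : irreflexive e.
Hypothesis bi : biconnected e.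
Hypothesis noK4 : ~ has_K4_subdivision e.
Hypothesis nte : no_transitive_edges e.
Hypothesis heavy2 : at_most_2_heavy e.

Record bridge_shape (s t : T) (C : {set T}) : Prop := BridgeShape {
  bridge_adj : forall y, y \in C -> e s y || e t y;
  bridge_tie : forall y y', y \in C -> e s y -> e t y -> y' \in C -> y' = y;
  bridge_indep_s : forall y y', y \in C -> y' \in C -> e s y -> e s y' -> ~~ e y y';
  bridge_indep_t : forall y y', y \in C -> y' \in C -> e t y -> e t y' -> ~~ e y y';
  bridge_complete : forall a b, a \in C -> b \in C -> e s a -> ~~ e t a -> e t b -> ~~ e s b -> e a b }.

Lemma attached_shape Z x s t : longest_cycle e Z -> x \notin Z -> s != t ->
  (forall z, attached e Z x z = (z == s) || (z == t)) ->
  bridge_shape s t (Defs.comp e [set:: Z] x).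
Proof.
move=> LZ xZ st att.
have sZ : s \in Z by apply: (attached_mem (e := e) (x := x)); rewrite att eqxx.
have tZ : t \in Z by apply: (attached_mem (e := e) (x := x)); rewrite att eqxx orbT.
have [n [A [B [ZE lA lB uAB]]]] := attached_arc LZ xZ st sZ tZ att.
have adj y : y \in Defs.comp e [set:: Z] x -> e s y || e t y.
  move=> yC; apply: (bridge_light_one e_sym e_irr bi noK4 nte heavy2 LZ (comp_notin_cycle xZ yC) st sZ tZ).
  by move=> z; rewrite (attached_comp e_sym _ yC).
have CE := comp_attached e_sym xZ sZ tZ att.
have unB : uniq (s :: t :: B).
  by apply/uniq_countP => z; have := elimT (uniq_countP _) uAB z; count_lia.
have xS : x \notin [set s; t].
  by rewrite in_set2; apply/negP => /orP[]/eqP xx; move: xZ; rewrite xx ?sZ ?tZ.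
have BC z : z \in B -> z \notin Defs.comp e [set s; t] x.
  move=> zB; rewrite CE; apply/negP => /(comp_notin_cycle xZ).
  by rewrite -(mem_rot n) ZE in_cons mem_cat in_cons zB !orbT.
rewrite -CE in adj *; split=> //.
- exact: (tie_alone e_sym e_irr noK4 nte lB unB xS BC adj).
- exact: (arm_indep e_sym e_irr bi noK4 nte st lB unB xS BC).
- exact: (arm_indep_t e_sym e_irr bi noK4 nte st lB unB xS BC).
- exact: (arms_complete e_sym e_irr bi noK4 nte st lB unB xS BC adj).
Qed.

Lemma exists_layout : exists (ro : T -> role) (l r g : T -> nat) (m : nat),
  layout_ok ro l r g m /\ forall u v, u != v -> e u v = layout_adj ro l r g u v.
Proof.
have [Y [w [LZ free]]] := exists_free_cycle e_sym e_irr bi noK4 nte.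
set Z := rcons Y w in LZ free; have [cZ uZ sZ _] := LZ.
pose m := size Y.
have sizeZ : size Z = m.+1 by rewrite size_rcons.
have memZ z : (z \in Z) = (z \in Y) || (z == w) by rewrite mem_rcons in_cons orbC.
have wY : w \notin Y by move: uZ; rewrite rcons_uniq => /andP[].
have iw : index w Z = m by rewrite /Z -cats1 index_cat (negbTE wY) /= eqxx addn0.
have iY z : z \in Y -> index z Z < m by move=> zY; rewrite /Z -cats1 index_cat zY index_mem.
have idx_inj u v : u \in Z -> v \in Z -> index u Z = index v Z -> u = v.
  by move=> uZ' vZ h; rewrite -(nth_index w uZ') h nth_index.
have m2 : 1 < m by rewrite -ltnS -sizeZ.
(* [z0] and [z1] are the neighbours of [w] on the cycle; [w] becomes a tie between the ends of the
   spine. *)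
pose z0 := nth w Y 0; pose z1 := nth w Y m.-1.
have z0Y : z0 \in Y by apply: mem_nth; rewrite -/m; lia.
have z1Y : z1 \in Y by apply: mem_nth; rewrite -/m; lia.
have uqY : uniq Y by move: uZ; rewrite rcons_uniq => /andP[].
have i0 : index z0 Z = 0 by rewrite /Z -cats1 index_cat z0Y index_uniq //; rewrite -/m; lia.
have i1 : index z1 Z = m.-1 by rewrite /Z -cats1 index_cat z1Y index_uniq //; rewrite -/m; lia.
pose spec v (d : T * T) := if v \in Y then d = (v, v) else if v == w then d = (z0, z1) else
  [/\ index d.1 Z < index d.2 Z, d.1 \in Y, d.2 \in Y &
   forall z, attached e Z v z = (z == d.1) || (z == d.2)].
have specP v : exists d, spec v d.
  rewrite /spec; case vY: (v \in Y); first by exists (v, v).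
  case vw: (v == w); first by exists (z0, z1).
  have vZ : v \notin Z by rewrite memZ vY vw.
  have [s [t [st sZ' tZ att]]] := attached_pair e_sym bi noK4 LZ vZ.
  have inY z : attached e Z v z -> z \in Y.
    move=> vz; have := attached_mem vz; rewrite memZ => /orP[//|/eqP zw].
    by have := free v vZ; rewrite -zw vz.
  have sY : s \in Y by apply: inY; rewrite att eqxx.
  have tY : t \in Y by apply: inY; rewrite att eqxx orbT.
  have : index s Z != index t Z by apply: contraNneq st => h; rewrite (idx_inj _ _ sZ' tZ h).
  rewrite neq_ltn => /orP[h|h]; [exists (s, t) | exists (t, s)]; split => //.
  by move=> z; rewrite att orbC.
have [d hd] := fin_all_exists specP.
pose ro v := if v \in Y then Spine else if v == w then Tie else
  if e (d v).1 v then (if e (d v).2 v then Tie else LeftArm) else RightArm.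
pose l v := index (d v).1 Z; pose r v := index (d v).2 Z.
(* The rank of the component among all vertex sets, so equal numbers mean equal components. *)
pose g v := nat_of_ord (enum_rank (Defs.comp e [set:: Z] v)).
have gP u v : g u = g v -> Defs.comp e [set:: Z] u = Defs.comp e [set:: Z] v.
  by move=> h; apply/enum_rank_inj/val_inj.
have spineE v : spine ro v = (v \in Y).
  by rewrite /spine /ro; case: ifP => // _; case: ifP => // _; do 2 case: ifP => //.
have lY v : v \in Y -> l v = index v Z /\ r v = index v Z.
  by move=> vY; have := hd v; rewrite /spec vY /l /r => ->.
have lw : l w = 0 /\ r w = m.-1.
  by have := hd w; rewrite /spec (negbTE wY) eqxx /l /r => ->.
have off v : v \notin Y -> v != w -> [/\ v \notin Z, index (d v).1 Z < index (d v).2 Z,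
    (d v).1 \in Y, (d v).2 \in Y & forall z, attached e Z v z = (z == (d v).1) || (z == (d v).2)].
  move=> vY vw; have := hd v; rewrite /spec (negbTE vY) (negbTE vw) => -[h1 h2 h3 h4].
  by split => //; rewrite memZ (negbTE vY).
(* [w] belongs to the deleted set, where [restr] has no edges; it thus forms a group of its own. *)
have compw : Defs.comp e [set:: Z] w = [set w].
  apply/setP => y; rewrite in_set1; apply/idP/eqP => [|->]; last exact: comp_refl.
  have : w \in [set:: Z] by rewrite inE memZ eqxx orbT.
  move=> wZ; move: y; apply: comp_ind => // y z -> _ _; by rewrite /restr wZ.
have gw v : g v = g w -> v \notin Y -> v = w.
  move=> /gP h vY; apply/eqP; rewrite -in_set1 -compw -h; exact: comp_refl.
have shape v : v \notin Y -> v != w -> bridge_shape (d v).1 (d v).2 (Defs.comp e [set:: Z] v).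
  move=> vY vw; have [vZ lt _ _ att] := off v vY vw.
  by apply: attached_shape => //; apply: contraTneq lt => ->; rewrite ltnn.
have same u v : u \notin Y -> v \notin Y -> u != w -> v != w -> g u = g v -> d u = d v.
  move=> uY vY uw vw /gP guv.
  have [uZ' ltu _ _ attu] := off u uY uw; have [vZ ltv _ _ attv] := off v vY vw.
  have vu : v \in Defs.comp e [set:: Z] u by rewrite guv comp_refl.
  have h z : (z == (d u).1) || (z == (d u).2) = (z == (d v).1) || (z == (d v).2).
    by rewrite -attu -attv (attached_comp e_sym _ vu).
  have := h (d u).1; have := h (d u).2; rewrite !eqxx orbT /=.
  case: (d u) (d v) ltu ltv {h attu attv} => [a b] [a' b'] /= ab ab'.
  move=> /esym/orP[]/eqP hb /esym/orP[]/eqP ha.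
  - by move: ab; rewrite ha hb ltnn.
  - by move: ab ab'; rewrite ha hb => /ltnW; rewrite leqNgt => /negbTE ->.
  - by rewrite ha hb.
  - by move: ab; rewrite ha hb ltnn.
exists ro, l, r, g, m; split.
  split.
  - by move=> u; rewrite spineE => uY; have [-> _] := lY u uY; exact: iY.
  - move=> u v; rewrite !spineE => uY vY; have [-> _] := lY u uY; have [-> _] := lY v vY.
    by apply: idx_inj; rewrite memZ ?uY ?vY.
  - move=> u; rewrite spineE => uY; have [->|uw] := eqVneq u w.
      by have [-> ->] := lw; lia.
    by have [_ lt _ dY _] := off u uY uw; rewrite lt iY.
  - move=> u v; rewrite !spineE => uY vY.
    (* The ends of [w] are the first and the last spine position, so its pair crosses no other. *)
    have [->|uw] := eqVneq u w; first by have [-> _] := lw.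
    have [uZ' ltu u1 u2 attu] := off u uY uw.
    have [->|vw] := eqVneq v w.
      have [_ ->] := lw => _ h; have := leq_ltn_trans h (iY _ u2).
      by rewrite prednK ?ltnn // ltnW.
    have [vZ ltv _ _ attv] := off v vY vw.
    rewrite /l /r => h1 h2.
    have u1' : attached e Z u (d u).1 by rewrite attu eqxx.
    have u2' : attached e Z u (d u).2 by rewrite attu eqxx orbT.
    have v1' : attached e Z v (d v).1 by rewrite attv eqxx.
    have v2' : attached e Z v (d v).2 by rewrite attv eqxx orbT.
    by have /andP[] := attached_nested e_sym noK4 LZ uZ' vZ u1' u2' v2' v1' h1 h2.
  - move=> u v; rewrite !spineE => uY vY.
    have [->|uw] := eqVneq u w; first by move=> /esym/gw ->.
    have [->|vw] := eqVneq v w; first by move=> /gw h; rewrite h // eqxx in uw.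
    by move=> /(same _ _ uY vY uw vw); rewrite /l /r => ->.
  - move=> u v; rewrite spineE => tu vY.
    have uY : u \notin Y by move: tu; rewrite /tie /ro; case: ifP.
    have [->|uw] := eqVneq u w; first by move=> /esym/gw ->.
    move=> /gP guv; have vu : v \in Defs.comp e [set:: Z] u by rewrite guv comp_refl.
    move: tu; rewrite /tie /ro (negbTE uY) (negbTE uw).
    case: ifP => // e1; case: ifP => // e2 _.
    by apply/esym/(bridge_tie (shape u uY uw) (comp_refl _ _ _) e1 e2 vu).
have spine_spine u v : u \in Y -> v \in Y -> u != v ->
    e u v = (l u == (l v).+1) || (l v == (l u).+1).
  move=> uY vY uv; have [-> _] := lY u uY; have [-> _] := lY v vY.
  have iu := iY u uY; have iv := iY v vY.
  have uZ' : u \in Z by rewrite memZ uY.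
  have vZ : v \in Z by rewrite memZ vY.
  have : index u Z != index v Z by apply: contraNneq uv => /idx_inj ->.
  rewrite neq_ltn => /orP[h|h].
    by rewrite (cycle_edge e_sym e_irr noK4 nte cZ uZ uZ' vZ h) sizeZ; move: h iv; clear; lia.
  by rewrite e_sym (cycle_edge e_sym e_irr noK4 nte cZ uZ vZ uZ' h) sizeZ; move: h iu; clear; lia.
have w_spine u : u \in Y -> e u w = (l u == l w) || (l u == r w).
  move=> uY; have [-> _] := lY u uY; have [-> ->] := lw.
  have iu := iY u uY; have h : index u Z < index w Z by rewrite iw.
  have uZ' : u \in Z by rewrite memZ uY.
  have wZ : w \in Z by rewrite memZ eqxx orbT.
  rewrite (cycle_edge e_sym e_irr noK4 nte cZ uZ uZ' wZ h) sizeZ iw; move: iu; clear; lia.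
have w_off u : u \notin Y -> u != w -> ~~ e u w.
  move=> uY uw; have [uZ' _ _ _ _] := off u uY uw.
  apply: contraNN (free u uZ') => /attached_adj -> //; by rewrite memZ eqxx orbT.
have off_spine u v : u \notin Y -> u != w -> v \in Y -> e v u = 
    (l v == l u) && e (d u).1 u || (l v == r u) && e (d u).2 u.
  move=> uY uw vY; have [uZ' lt d1 d2 att] := off u uY uw.
  have [-> _] := lY v vY; rewrite /l /r.
  have vZ : v \in Z by rewrite memZ vY.
  have idE z : z \in Y -> (index v Z == index z Z) = (v == z).
    move=> zY; apply/eqP/eqP => [|->//]; by apply: idx_inj; rewrite // memZ zY.
  rewrite !idE //; apply/idP/idP => [evu|/orP[]/andP[/eqP ->]//].
  have : attached e Z u v by apply: attached_adj; rewrite // e_sym.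
  by rewrite att => /orP[]/eqP <-; rewrite evu eqxx ?orbT.
(* Two vertices of one component are private neighbours of [s] or of [t], and are adjacent exactly
   when they are on opposite sides. *)
have off_off u v : u \notin Y -> v \notin Y -> u != w -> v != w -> u != v ->
    e u v = (g u == g v) && (e (d u).1 u != e (d u).1 v).
  move=> uY vY uw vw uv; have [uZ' _ _ _ _] := off u uY uw; have [vZ _ _ _ _] := off v vY vw.
  have [guv|ne] := eqVneq (g u) (g v); last first.
    apply/negbTE; apply: contraNN ne => euv; rewrite /g.
    suff -> : Defs.comp e [set:: Z] v = Defs.comp e [set:: Z] u by [].
    apply: (compP e_sym); apply: comp_step euv _ _; rewrite ?inE //; exact: comp_refl.
  have sh := shape u uY uw.
  have uu := comp_refl e [set:: Z] u.
  have vu : v \in Defs.comp e [set:: Z] u by rewrite (gP _ _ guv) comp_refl.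
  have := bridge_adj sh uu; have := bridge_adj sh vu.
  have := bridge_indep_s sh uu vu; have := bridge_indep_t sh uu vu.
  have := bridge_tie sh uu; have := bridge_tie sh vu.
  have := bridge_complete sh uu vu; have := bridge_complete sh vu uu.
  rewrite (e_sym v u) /=.
  have vuN : v <> u by apply/eqP; rewrite eq_sym.
  have uvN : u <> v by apply/eqP.
  (* Each truth assignment that violates the claim is refuted by one property of the shape. *)
  case: (e (d u).1 u); case: (e (d u).2 u); case: (e (d u).1 v); case: (e (d u).2 v); case: (e u v) => //=;
  by move=> h1 h2 h3 h4 h5 h6 _ _;
     first [by have := h1 isT isT isT isT | by have := h2 isT isT isT isT
       | by case: uvN; apply: h3 | by case: vuN; apply: h4 | by have := h5 isT isT | by have := h6 isT isT].
have offadj u : u \notin Y -> u != w -> e (d u).1 u || e (d u).2 u.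
  by move=> uY uw; apply: (bridge_adj (shape u uY uw)); exact: comp_refl.
move=> u v uv.
have [uY|uY] := boolP (u \in Y).
  have [vY|vY] := boolP (v \in Y).
    by rewrite /layout_adj /ro uY vY spine_spine.
  have [vw|vw] := eqVneq v w.
    by rewrite /layout_adj /ro uY vw (negbTE wY) eqxx w_spine.
  rewrite /layout_adj /ro uY (negbTE vY) (negbTE vw) off_spine //.
  by have := offadj v vY vw; case: (e _ v) => /=; case: (e _ v) => //=; rewrite ?andbT ?andbF ?orbF.
have [vY|vY] := boolP (v \in Y).
  rewrite e_sym; have [uw|uw] := eqVneq u w.
    by rewrite /layout_adj /ro vY uw (negbTE wY) eqxx w_spine.
  rewrite /layout_adj /ro vY (negbTE uY) (negbTE uw) off_spine //.
  by have := offadj u uY uw; case: (e _ u) => /=; case: (e _ u) => //=; rewrite ?andbT ?andbF ?orbF.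
have [uw|uw] := eqVneq u w.
  have vw : v != w by rewrite -uw eq_sym.
  rewrite /layout_adj /ro uw (negbTE wY) eqxx (negbTE vY) (negbTE vw) e_sym (negbTE (w_off v vY vw)).
  by case: (e _ v); case: (e _ v).
have [vw|vw] := eqVneq v w.
  rewrite /layout_adj /ro vw (negbTE wY) eqxx (negbTE uY) (negbTE uw) (negbTE (w_off u uY uw)).
  by case: (e _ u); case: (e _ u).
rewrite off_off // /layout_adj /ro (negbTE uY) (negbTE vY) (negbTE uw) (negbTE vw).
have [guv|ne] := eqVneq (g u) (g v); last by do 5 case: (e _ _).
rewrite (same u v) //=.
have := offadj u uY uw; have := offadj v vY vw; rewrite (same u v) //.
have sh := shape v vY vw.
have vv := comp_refl e [set:: Z] v.
have uC : u \in Defs.comp e [set:: Z] v by rewrite -(gP _ _ guv) comp_refl.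
have := bridge_tie sh vv; have := bridge_tie sh uC.
have vuN : v <> u by apply/eqP; rewrite eq_sym.
have uvN : u <> v by apply/eqP.
case: (e (d v).1 u); case: (e (d v).2 u); case: (e (d v).1 v); case: (e (d v).2 v) => //= h1 h2 _ _;
 by first [by case: vuN; apply: h1 | by case: uvN; apply: h2].
Qed.
End LayoutOfGraph.

From mathcomp Require Import all_order all_algebra.
From mathcomp Require Import all_classical all_reals topology normedtype.
From mathcomp Require Import Rstruct Rstruct_topology.
From mathcomp Require Import ring lra.

Import Order.TTheory GRing.Theory Num.Theory numFieldNormedType.Exports.
Local Open Scope classical_set_scope.
Local Open Scope ring_scope.

(** * Curves of the drawing *)

Section LCurve.
Variable R : realType.
Implicit Types a h w t : R.

(** The curve descends for [t] up to 1/2 and then runs sideways; [max] and [min] freeze the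
    coordinate that is at rest. *)
Definition Lcurve a h w t : R * R :=
  (a + w * Num.max 0 (2 * t - 1), - h * Num.min 1 (2 * t)).

Lemma Lcurve_cont a h w : continuous (Lcurve a h w).
Proof.
have c2 : continuous (fun t : R => 2 * t).
  by move=> t; apply: cvgM; [exact: cvg_cst | exact: cvg_id].
have c1 : continuous (fun t : R => 2 * t - 1).
  by move=> t; apply: cvgB; [exact: c2 | exact: cvg_cst].
have c3 : continuous (fun t => a + w * Num.max 0 (2 * t - 1)).
  move=> t; apply: cvgD; first exact: cvg_cst.
  apply: cvgM; first exact: cvg_cst.
  by apply: (@continuous_max _ _ (fun=> 0) (fun t => 2 * t - 1)); [exact: cvg_cst | exact: c1].
have c4 : continuous (fun t => - h * Num.min 1 (2 * t)).
  move=> t; apply: cvgM; first exact: cvg_cst.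
  by apply: (@continuous_min _ _ (fun=> 1) (fun t => 2 * t)); [exact: cvg_cst | exact: c2].
move=> t; exact: (cvg_pair (c3 t) (c4 t)).
Qed.

Lemma Lcurve_image a h w : 0 < h -> Lcurve a h w @` @I01 R = Lshape a h w.
Proof.
move=> h0; apply/seteqP; split => [_ [t /andP[t0 t1] <-]|[x y]] /=.
- rewrite /Lcurve /Lshape /=.
  have [th|th] := leP t 2^-1.
  + left; rewrite max_l ?min_r; try lra. split; first by lra.
    by apply/andP; split; nra.
  + right; have -> : Num.max 0 (2 * t - 1) = 2 * t - 1 by rewrite max_r //; lra.
    have -> : Num.min 1 (2 * t) = 1 by rewrite min_l //; lra.
    split; first by lra.
    have k0 : 0 <= 2 * t - 1 by lra.
    have k1 : 0 <= 2 - 2 * t by lra.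
    have [w0|w0] := ltP 0 w.
      rewrite min_l ?max_r ?lerDl ?(ltW w0) //.
      by have := mulr_ge0 (ltW w0) k0; have := mulr_ge0 (ltW w0) k1; lra.
    rewrite min_r ?max_l ?gerDl //.
    by have := mulr_le0_ge0 w0 k0; have := mulr_le0_ge0 w0 k1; lra.
- case=> /= [[-> /andP[y0 y1]]|[-> ]].
  + exists (- y / h / 2).
      rewrite /I01 /=; apply/andP; split.
        by rewrite !divr_ge0 ?oppr_ge0 ?(ltW h0).
      rewrite ler_pdivrMr // ler_pdivrMr //; lra.
    have h1 : - y / h <= 1 by rewrite ler_pdivrMr //; lra.
    have h2 : 2 * (- y / h / 2) = - y / h by rewrite mulrC divfK // pnatr_eq0.
    rewrite /Lcurve h2 max_l ?min_r //; last lra.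
    by congr pair; [lra | rewrite mulNr mulrC divfK ?opprK // gt_eqF].
  + have [->|w0] := eqVneq w 0.
      rewrite addr0 minxx maxxx => hx.
      exists 1; first by rewrite /I01 /= ler01 lexx.
      rewrite /Lcurve min_l; last lra.
      congr pair; lra.
    move=> hx; have hx1 : 0 <= (x - a) / w <= 1.
      move: hx; rewrite /Num.min /Num.max; case: ltP => hw /andP[hx1 hx2].
        have w1 : 0 < w by lra.
        by apply/andP; split; [rewrite divr_ge0 //; lra | rewrite ler_pdivrMr //; lra].
      have w1 : w < 0 by rewrite lt_neqAle w0; lra.
      apply/andP; split; [|rewrite ler_ndivrMr //; lra].
      by rewrite ler_ndivlMr //; lra.
    exists (((x - a) / w + 1) / 2).
      by rewrite /I01 /=; lra.
    have h2 : 2 * (((x - a) / w + 1) / 2) = (x - a) / w + 1 by rewrite mulrC divfK // pnatr_eq0.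
    rewrite /Lcurve h2 addrK; move/andP: hx1 => [hx1 hx2].
    rewrite (max_r hx1) min_l; last lra.
    by congr pair; [rewrite mulrC divfK //; lra | lra].
Qed.

Lemma Lcurve_grounded a h w : 0 < h -> w != 0 -> grounded_curve (Lcurve a h w).
Proof.
move=> h0 w0; split.
- by apply: continuous_subspaceT => ?; apply: Lcurve_cont.
- move=> s t /andP[s0 s1] /andP[t0 t1] [] e1 e2.
  have e1' : Num.max 0 (2 * s - 1) = Num.max 0 (2 * t - 1).
    by apply: (mulfI w0); lra.
  have e2' : Num.min 1 (2 * s) = Num.min 1 (2 * t).
    by apply: (@mulfI _ (- h)); [rewrite oppr_eq0 gt_eqF | lra].
  move: e1' e2'; rewrite /Num.min /Num.max.
  by do 4 case: ltP => ?; lra.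
- by rewrite /Lcurve /= mulr0 min_r ?mulr0 ?ler01.
- move=> t /andP[t0 t1]; rewrite /Lcurve /=.
  have : 0 < Num.min 1 (2 * t) by rewrite lt_min ltr01 /=; lra.
  by nra.
Qed.

Lemma meets_image (g1 g2 : R -> R * R) :
  Defs.meets g1 g2 <-> (g1 @` (@I01 R)) `&` (g2 @` (@I01 R)) !=set0.
Proof.
split => [[s [t [hs ht e]]]|[p [[s hs es] [t ht et]]]].
  by exists (g1 s); split; [exists s | exists t].
by exists s, t; split => //; rewrite es et.
Qed.

End LCurve.

(** A range extends to one side of [x] only, so one signed length [w] encodes it. *)
Lemma reach_range (R : realFieldType) (lo x hi : R) :
  lo <= x -> x <= hi -> (lo == x) || (hi == x) ->
  let w := if lo < x then lo - x else hi - x + 2^-1 in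
  Num.min x (x + w) = lo /\
  (hi <= Num.max x (x + w) <= hi + 2^-1) /\ w != 0.
Proof.
move=> h1 h2 h3 /=; have [c|c] := ltP lo x.
  move: h3; rewrite lt_eqF //= => /eqP h3.
  have -> : x + (lo - x) = lo by lra.
  by rewrite min_r ?max_l //; split=> //; split; [lra | rewrite subr_eq0 lt_eqF].
have -> : x + (hi - x + 2^-1) = hi + 2^-1 by lra.
have -> : lo = x by lra.
have h4 : x <= hi + 2^-1 by lra.
by rewrite min_l ?max_r //; split=> //; split; [lra | rewrite gt_eqF //; lra].
Qed.

(** * The drawing of a layout by one-bend curves *)

Section Drawing.
Variables (R : realType) (T : finType) (e : rel T).
Variables (ro : T -> role) (l r g : T -> nat) (m : nat).
Hypothesis Hok : layout_ok ro l r g m.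
Hypothesis He : forall u v, u != v -> e u v = layout_adj ro l r g u v.

Let x u : R := (abscissa ro l r g m u)%:R.
(** The shift by one puts every horizontal segment strictly below the ground line. *)
Let d u : R := (depth ro l r g m u).+1%:R.
Let lo' u : R := (reach_lo ro l r g m u)%:R.
Let hi' u : R := (reach_hi ro l r g m u)%:R.
(* The extra 1/2 makes every horizontal segment nondegenerate, so that [Lcurve] is injective. *)
Let w u : R := if lo' u < x u then lo' u - x u else hi' u - x u + 2^-1.

Let w_range u : Num.min (x u) (x u + w u) = lo' u /\
  (hi' u <= Num.max (x u) (x u + w u) <= hi' u + 2^-1) /\ w u != 0.
Proof.
have := reach_abscissa Hok u => /andP[/andP[]].
rewrite -(ler_nat R) -/(lo' u) -/(x u) => h1.
rewrite -(ler_nat R) -/(hi' u) -/(x u) => h2.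
rewrite -(eqr_nat R) -/(lo' u) -/(x u).
rewrite -(eqr_nat R) -/(hi' u) -/(x u) => h3.
exact: reach_range.
Qed.

(** Verticals have distinct abscissas and horizontals of equal depth are disjoint, so a meeting
    point lies on the vertical of one shape and the horizontal of the other. *)
Lemma Lshape_meets u v : u != v ->
  Lshape (x u) (d u) (w u) `&` Lshape (x v) (d v) (w v) !=set0 <-> e u v.
Proof.
move=> uv; rewrite He //.
have [nx nd ->] := layout_meets Hok uv.
have xx : x u != x v by rewrite eqr_nat.
have [l1 [/andP[l2 l3] _]] := w_range u.
have [r1 [/andP[r2 r3] _]] := w_range v.
have du : 0 < d u by rewrite ltr0n.
have dv : 0 < d v by rewrite ltr0n.
(* Coordinates are integers, so the extra 1/2 of a segment reaches no further vertical. *)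
have half (a b : nat) : a%:R <= b%:R + 2^-1 :> R -> (a <= b)%N.
  by move=> h; rewrite -ltnS -(ltr_nat R) -natr1; lra.
split.
- move=> [[px py]] [] [] /= [e1 e2] [] /= [e3 e4].
  + by move: xx; rewrite -e1 -e3 eqxx.
  + move: e2 e4; rewrite e3 e1 r1 => /andP[e5 _] /andP[e6 e7].
    apply/orP; right; apply/andP; split; last first.
      by rewrite -ltnS -(ler_nat R) -/(d u) -/(d v); lra.
    apply/andP; split; first by rewrite -(ler_nat R).
    by apply: half; apply: le_trans e7 _.
  + move: e2 e4; rewrite e1 e3 l1 => /andP[e6 e7] /andP[e5 _].
    apply/orP; left; apply/andP; split; last first.
      by rewrite -ltnS -(ler_nat R) -/(d u) -/(d v); lra.
    apply/andP; split; first by rewrite -(ler_nat R).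
    by apply: half; apply: le_trans e7 _.
  + have dd : d u == d v by apply/eqP; lra.
    move: dd nd; rewrite eqr_nat eqSS => -> /= /orP[] h; exfalso; move: h; rewrite ltnNge => /negP; apply.
      apply: half; move: e4 e2; rewrite l1 r1 => /andP[a1 a2] /andP[a3 a4].
      by apply: le_trans a1 _; apply: le_trans a4 _.
    apply: half; move: e4 e2; rewrite l1 r1 => /andP[a1 a2] /andP[a3 a4].
    by apply: le_trans a3 _; apply: le_trans a2 _.
- case/orP=> /andP[/andP[h1 h2] h3].
  + exists (x v, - d u); split => /=.
      right; split => //; rewrite l1 ler_nat h1 /=.
      by apply: le_trans l2; rewrite ler_nat.
    by left; split => //; rewrite lerN2 ler_nat ltnS h3 /=; lra.
  + exists (x u, - d v); split => /=; last first.
      right; split => //; rewrite r1 ler_nat h1 /=.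
      by apply: le_trans r2; rewrite ler_nat.
    by left; split => //; rewrite lerN2 ler_nat ltnS h3 /=; lra.
Qed.

Lemma layout_LGamma : has_LGamma_mirror_rep R e.
Proof.
have d0 u : 0 < d u by rewrite ltr0n.
exists (fun u => Lcurve (x u) (d u) (w u)); split.
  split => [v|u v uv]; first by apply: Lcurve_grounded => //; case: (w_range v) => _ [].
  by rewrite meets_image !Lcurve_image //; apply: Lshape_meets.
move=> v; exists (x v), (d v), (w v); split => //.
exact: Lcurve_image.
Qed.

End Drawing.

(** * Crossing of connected sets in a half-plane *)

(** To be applied to ordinates: between corners of a grid cell the difference changes by less than
    [2 * eps], so a change of sign forces it to be small. *)
Lemma cell_abscissa (R : realDomainType) (eps a b c d : R) :
  - eps < a - b -> a - b < eps -> - eps < c - d -> c - d < eps ->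
  ~~ [&& (c <= a) == (c <= b), (c <= a) == (d <= a) & (c <= a) == (d <= b)] ->
  - (3 * eps) < a - c < 3 * eps.
Proof.
move=> h1 h2 h3 h4; case: (leP c a) => ?; case: (leP c b) => ?; case: (leP d a) => ?;
  by case: (leP d b) => ? //= _; apply/andP; split; lra.
Qed.

(** To be applied to abscissas: a difference of size at least [4 * eps] keeps its sign over the
    cell. *)
Lemma cell_ordinate (R : realDomainType) (eps a b c d : R) :
  - eps < a - b -> a - b < eps -> - eps < c - d -> c - d < eps ->
  ~~ (- (4 * eps) < a - c < 4 * eps) ->
  [/\ (d < a) = (c < a), (c < b) = (c < a) & (d < b) = (c < a)].
Proof.
move=> h1 h2 h3 h4; case: (ltP (- (4 * eps)) (a - c)) => /= [_|h5 _].
  rewrite -leNgt => h5; have -> : c < a by lra.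
  by split; lra.
have -> : (c < a) = false by apply/negbTE; rewrite -leNgt; lra.
by split; apply/negbTE; rewrite -leNgt; lra.
Qed.

Section DiscreteCrossing.
Variable R : realDomainType.
Implicit Types (p q : nat -> R * R) (m n : nat).

Definition near2 (eps : R) (a b : R * R) : bool :=
  (`|a.1 - b.1| < eps) && (`|a.2 - b.2| < eps).

Variables (p q : nat -> R * R) (m n : nat) (eps : R).
Hypothesis pstep : forall i, (i < m)%N -> near2 eps (p i) (p i.+1).
Hypothesis qstep : forall j, (j < n)%N -> near2 eps (q j) (q j.+1).
Hypothesis far : forall i j, (i <= m)%N -> (j <= n)%N -> ~~ near2 (4%:R * eps) (p i) (q j).
Hypothesis q_le0 : forall j, (j <= n)%N -> (q j).2 <= 0.
Hypothesis p_lt0 : forall i, (0 < i < m)%N -> (p i).2 < 0.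
Hypotheses (p0 : (p 0%N).2 = 0) (pm : (p m).2 = 0) (q0 : (q 0%N).2 = 0) (qn : (q n).2 = 0).
Hypotheses (ab : (p 0%N).1 < (q 0%N).1) (bc : (q 0%N).1 < (p m).1) (cd : (p m).1 < (q n).1).

(* Signs of the ordinate and of the abscissa of p i - q j. *)
Let lab i j := (q j).2 <= (p i).2.
Let rgt i j := (q j).1 < (p i).1.
(** Seen from [q j], the step from [p i] to [p i.+1] crosses the horizontal ray pointing right. *)
Let hedge i j := (lab i j (+) lab i.+1 j) && rgt i j.

(** A change of label makes the ordinates close; as the points are far apart, their abscissas differ
    so much that the side is constant on the cell. *)
Lemma cell_rgt i j : (i < m)%N -> (j < n)%N ->
  ~~ [&& lab i j == lab i.+1 j, lab i j == lab i j.+1 & lab i j == lab i.+1 j.+1] ->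
  [/\ rgt i j.+1 = rgt i j, rgt i.+1 j = rgt i j & rgt i.+1 j.+1 = rgt i j].
Proof.
move=> im jn.
have := far (ltnW im) (ltnW jn); have := far im (ltnW jn).
have := far (ltnW im) jn; have := far im jn.
have := pstep im; have := qstep jn.
rewrite /lab /rgt /near2 !ltr_norml.
move: (p i) (p i.+1) (q j) (q j.+1) => [a1 a2] [b1 b2] [c1 c2] [d1 d2] /=.
move=> /andP[/andP[x1 x2] /andP[x3 x4]] /andP[/andP[y1 y2] /andP[y3 y4]].
move=> f1 f2 f3 f4 h.
have h3 := cell_abscissa y3 y4 x3 x4 h.
have F1 : ~~ (- (4 * eps) < a1 - c1 < 4 * eps).
  move: f4; case: (- (4 * eps) < a1 - c1 < 4 * eps) => //=; move: h3; lra.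
by have [] := cell_ordinate y1 y2 x1 x2 F1.
Qed.

(** On each cell the four edges cancel modulo 2: either the labels agree, or the side is constant
    and the label changes around the cell sum to zero. Over a row the vertical edges telescope, and
    the outer two vanish because [p 0] and [p m] lie on the ground, never below [q]. *)
Lemma row_change j : (j < n)%N -> (0 < m)%N ->
   \big[addb/false]_(i < m) hedge i j = \big[addb/false]_(i < m) hedge i j.+1.
Proof.
move=> jn _.
pose vedge i := (lab i j (+) lab i j.+1) && rgt i j.
have lab0 j' : (j' <= n)%N -> lab 0 j' by move=> h; rewrite /lab p0 q_le0.
have labm j' : (j' <= n)%N -> lab m j' by move=> h; rewrite /lab pm q_le0.
have H k : (k <= m)%N -> \big[addb/false]_(i < k) hedge i j (+)
   \big[addb/false]_(i < k) hedge i j.+1 = vedge 0%N (+) vedge k.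
  elim: k => [|k IH] km; first by rewrite !big_ord0 /= addbb.
  rewrite !big_ord_recr /=.
  have {}IH := IH (ltnW km).
  rewrite addbACA IH -addbA; congr addb.
  rewrite /vedge /hedge; case E: [&& lab k j == lab k.+1 j, lab k j == lab k j.+1 & lab k j == lab k.+1 j.+1].
    by case/and3P: E => /eqP <- /eqP <- /eqP <-; rewrite !addbb.
  have [-> -> _] := cell_rgt km jn (negbT E).
  by case: (rgt k j); rewrite ?andbF ?andbT //; do 4 case: lab.
have := H m (leqnn m).
rewrite /vedge !lab0 ?labm ?(ltnW jn) //= => /eqP.
by case: (\big[_/_]_(_ < _) _); case: (\big[_/_]_(_ < _) _).
Qed.

(* Row 0 has an odd and row n an even number of label changes at positive abscissa, while
   [row_change] makes this parity independent of the row. *)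
Lemma no_discrete_crossing : False.
Proof.
have m0 : (0 < m)%N.
  by case: (posnP m) bc ab => // ->; lra.
have far0 i j : (i <= m)%N -> (j <= n)%N -> (p i).2 = 0 -> (q j).2 = 0 ->
    4 * eps <= `|(p i).1 - (q j).1|.
  move=> im jn pi0 qj0; have := far im jn; rewrite /near2 pi0 qj0 subrr normr0.
  have eps0 : 0 < eps.
    by have := pstep m0; rewrite /near2 => /andP[h _]; apply: le_lt_trans h.
  by rewrite pmulr_rgt0 // eps0 andbT -leNgt.
(* For [q j] on the ground, only the two ends of [p] carry the label true, so only the first and the
   last step can count; the first does not, since [p 0] is to the left of [q j]. *)
have last_rgt j : (j <= n)%N -> (q j).2 = 0 -> (p 0%N).1 < (q j).1 ->
    \big[addb/false]_(i < m) hedge i j = rgt m j.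
  move=> jn qj0 pj.
  have m1 : m = m.-1.+1 by rewrite prednK.
  have := @pstep m.-1; rewrite -m1 leqnn /near2 => /(_ isT) /andP[st _].
  have fm := far0 m j (leqnn _) jn pm qj0.
  have f0 := far0 0%N j isT jn p0 qj0.
  rewrite m1 big_ord_recr big1 /=; last first.
    move=> [i im] _ /=; rewrite /hedge /lab qj0.
    case: i im => [|i] im.
      by rewrite /rgt (lt_gtF pj) andbF.
    have h1 : (p i.+1).2 < 0 by apply: p_lt0; lia.
    have h2 : (p i.+2).2 < 0 by apply: p_lt0; rewrite -ltn_predRL.
    by rewrite !leNgt h1 h2.
  rewrite /hedge -m1 /lab qj0 pm lexx addbT.
  have hr : rgt m.-1 j = rgt m j.
    move: st fm; rewrite /rgt => st.
    rewrite ler_normr => /orP fm.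
    move: st; rewrite ltr_norml => /andP[s1 s2].
    by case: ltP => ?; case: ltP => ? //; lra.
  (* With a single step, [p] cannot jump over [q j], which is far from both ends. *)
  case: (posnP m.-1) => [e0|mp].
    move: st f0 hr; rewrite /rgt e0 p0 lexx => st f0 ->.
    rewrite (ltNge (q j).1 (p m).1); case: leP => //= pq; exfalso.
    move: f0; rewrite ler_normr => /orP f0.
    move: st; rewrite ltr_norml => /andP[s1 s2]; lra.
  have h1 : (p m.-1).2 < 0 by apply: p_lt0; rewrite mp ltn_predL.
  by rewrite leNgt h1 hr.
have row j : (j <= n)%N -> \big[addb/false]_(i < m) hedge i 0 = \big[addb/false]_(i < m) hedge i j.
  by elim: j => // j IH jn; rewrite IH ?(ltnW jn) // row_change.
have := row n (leqnn n); rewrite !last_rgt //; last by apply: (lt_trans (lt_trans ab bc)).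
by rewrite /rgt bc ltNge ltW.
Qed.
End DiscreteCrossing.

Section ConnectedCrossing.
Variable R : realType.

(** The points reachable from [x] by [eps]-chains form a nonempty, relatively open and closed subset
    of [A]. *)
Lemma connected_chain (X : pseudoMetricType R) (A : set X) (eps : R) (x y : X) :
  0 < eps -> connected A -> A x -> A y ->
  exists (n : nat) (q : nat -> X), [/\ q 0%N = x, q n = y,
    forall j, (j <= n)%N -> A (q j) &
    forall j, (j < n)%N -> ball (q j) eps (q j.+1)].
Proof.
move=> e0 cA Ax Ay.
pose chain z := exists (n : nat) (q : nat -> X), [/\ q 0%N = x, q n = z,
    forall j, (j <= n)%N -> A (q j) &
    forall j, (j < n)%N -> ball (q j) eps (q j.+1)].
have step a b : chain a -> A b -> ball a eps b -> chain b.
  move=> [n [q [q0 qn qA qs]]] Ab ab.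
  exists n.+1, (fun j => if (j <= n)%N then q j else b); split => //.
  - by rewrite ltnn.
  - by move=> j _; case: ifP => // /qA.
  - move=> j jn; case: ltnP => jn'; first by rewrite ltnW //; exact: qs.
    by have -> : j = n by [lia]; rewrite leqnn qn.
suff AchainE : A `&` chain = A by have : (A `&` chain) y by [rewrite AchainE]; case.
apply: cA.
- exists x; split => //; exists 0%N, (fun=> x); split => // j; by rewrite ltn0.
- exists (\bigcup_(a in A `&` chain) (ball a eps)°).
    by apply: bigcup_open => a _; exact: open_interior.
  apply/seteqP; split => z [Az Cz]; split => //.
    by exists z => //; apply: nbhsx_ballx.
  by case: Cz => a [Aa Ca] /interior_subset; exact: step.
- exists (~` \bigcup_(a in A `\` chain) (ball a eps)°).
    by apply: open_closedC; apply: bigcup_open => a _; exact: open_interior.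
  apply/seteqP; split => z [Az Cz]; split => //.
    move=> [a [Aa Ca]] /interior_subset /ball_sym za; apply: Ca.
    exact: step Cz Aa za.
  apply: contrapT => nz; apply: Cz; exists z => //.
  exact: nbhsx_ballx.
Qed.

(** Each point of [K] has a positive distance to [L]; compactness makes the bound uniform. *)
Lemma compact_separation (X : pseudoMetricType R) (K L : set X) :
  compact K -> closed L -> K `&` L = set0 ->
  exists2 eps : R, 0 < eps & forall a b, K a -> L b -> ~ ball a eps b.
Proof.
move=> cK cL KL.
pose P (e : R) a := forall b, L b -> ~ ball a e b.
have : \forall e \near 0^'+, K `<=` P e.
  apply: ((compact_near_coveringP K).1 cK R 0^'+ P) => a Ka.
  have : nbhs a (~` L).
    apply: open_nbhs_nbhs; split; first exact: closed_openC.
    by move=> La; have : (K `&` L) a by []; rewrite KL.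
  move=> /nbhs_ballP[e /= e0 aL].
  have e20 : 0 < e / 2 by rewrite divr_gt0.
  exists (ball a (e / 2), [set d | 0 < d < e / 2]) => /=.
    split; first exact: nbhsx_ballx.
    near=> d; apply/andP; split; near: d; first exact: nbhs_right_gt.
    exact: nbhs_right_lt.
  move=> [a' d] /= [aa' /andP[d0 d1]] b Lb ab.
  apply: (aL b) => //.
  have -> : e = e / 2 + e / 2 by lra.
  apply: (ball_triangle aa'); apply: le_ball ab; exact: ltW.
move=> h; near (0 : R)^'+ => d.
have Kd : K `<=` P d by near: d.
exists d; first by near: d; exact: nbhs_right_gt.
by move=> a b Ka; exact: Kd.
Unshelve. all: by end_near. Qed.

Lemma ball_near2 (a b : R * R) eps : ball a eps b <-> near2 eps a b.
Proof. by rewrite /near2; split => [[h1 h2]|/andP[h1 h2]]; [apply/andP|]. Qed.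

(** Disjoint [K] and [L] would have a positive distance, and fine chains in them would contradict
    [no_discrete_crossing]. *)
Lemma connected_crossing (K L : set (R * R)) (a b c d : R) :
  compact K -> connected K -> compact L -> connected L ->
  (forall z, K z \/ L z -> z.2 <= 0) ->
  K (a, 0) -> K (c, 0) -> L (b, 0) -> L (d, 0) ->
  a < b -> b < c -> c < d -> K `&` L !=set0.
Proof.
move=> cK oK cL oL le0 Ka Kc Lb Ld ab bc cd; apply: contrapT => nKL.
have KL : K `&` L = set0.
  by apply/seteqP; split => // z hz; case: nKL; exists z.
have haus : hausdorff_space (R * R)%type by exact: norm_hausdorff.
have [e e0 sep] := compact_separation cK (compact_closed haus cL) KL.
(* The chains must stay [4 * (2 * f)] apart, and the shift of [p] costs one more [f]. *)
pose f := e / 9.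
have f0 : 0 < f by rewrite divr_gt0.
have [m [p [p0 pm pK ps]]] := connected_chain f0 oK Ka Kc.
have [n [q [q0 qn qL qs]]] := connected_chain f0 oL Lb Ld.
(* Lowering the inner points by [f] makes their ordinates negative; steps stay shorter than
   [2 * f]. *)
pose p' i := if (0 < i < m)%N then ((p i).1, (p i).2 - f) else p i.
have p'0 : p' 0%N = (a, 0) by rewrite /p' /=.
have p'm : p' m = (c, 0) by rewrite /p' ltnn andbF.
have p'p i : (p' i).1 = (p i).1 /\ (p i).2 - f <= (p' i).2 <= (p i).2.
  by rewrite /p'; case: ifP => _ /=; split => //; lra.
apply: (@no_discrete_crossing R p' q m n (2 * f)) => //; rewrite ?p'0 ?p'm ?q0 ?qn //=.
- move=> i im; have /ball_near2 := ps i im.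
  rewrite /near2; have [-> h1] := p'p i; have [-> h2] := p'p i.+1.
  rewrite !ltr_norml; lra.
- move=> j jn; have /ball_near2 := qs j jn.
  rewrite /near2 !ltr_norml; lra.
- move=> i j im jn; apply/negP => h.
  apply: (sep _ _ (pK i im) (qL j jn)); apply/ball_near2.
  move: h; rewrite /near2; have [-> h1] := p'p i.
  have -> : e = 9 * f by rewrite /f; lra.
  rewrite !ltr_norml; lra.
- by move=> j jn; apply: le0; right; exact: qL.
- move=> i im; rewrite /p' im /=.
  have : (p i).2 <= 0 by apply: le0; left; apply: pK; lia.
  by lra.
Qed.

End ConnectedCrossing.

(** * Unions of grounded curves along walks *)

Section GroundedWalks.
Variables (R : realType) (T : finType) (e : rel T) (g : T -> R -> R * R).
Hypothesis rep : grounded_string_rep e g.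

Definition trace (v : T) : set (R * R) := g v @` @I01 R.
Definition traces (s : seq T) : set (R * R) := [set z | exists2 v, v \in s & trace v z].
Definition anchor (v : T) : R := (g v 0).1.

Lemma I01E : @I01 R = `[0, 1]%classic.
Proof. by apply/seteqP; split => t; rewrite /I01 /= in_itv. Qed.

Lemma trace_compact v : compact (trace v).
Proof.
have [cg _ _ _] := rep.1 v.
by apply: continuous_compact => //; rewrite I01E; exact: segment_compact.
Qed.

Lemma trace_connected v : connected (trace v).
Proof.
have [cg _ _ _] := rep.1 v.
apply: connected_continuous_connected => //.
by rewrite I01E; apply/connected_intervalP; exact: interval_is_interval.
Qed.

Lemma trace_anchor v : trace v (anchor v, 0).
Proof.
have [_ _ g0 _] := rep.1 v; exists 0; first by rewrite /I01 /= lexx ler01.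
by rewrite /anchor [LHS]surjective_pairing g0.
Qed.

Lemma trace_le0 v z : trace v z -> z.2 <= 0.
Proof.
have [_ _ g0 gneg] := rep.1 v; move=> [t /andP[t0 t1] <-].
by move: t0; rewrite le_eqVlt => /orP[/eqP <-|t0]; rewrite ?g0 // ltW // gneg // t0.
Qed.

Lemma tracesS x s : traces (x :: s) = trace x `|` traces s.
Proof.
apply/seteqP; split => z.
  by move=> [v]; rewrite inE => /orP[/eqP ->|vs] vz; [left | right; exists v].
by move=> [xz|[v vs vz]]; [exists x; rewrite ?mem_head | exists v; rewrite // inE vs orbT].
Qed.

Lemma traces_compact s : compact (traces s).
Proof.
elim: s => [|x s IH]; last by rewrite tracesS; apply: compactU => //; exact: trace_compact.
have -> : traces [::] = set0 by apply/seteqP; split => z // -[].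
exact: compact0.
Qed.

(** Consecutive vertices are adjacent, so consecutive curves meet. *)
Lemma traces_connected x p : irreflexive e -> path e x p -> connected (traces (x :: p)).
Proof.
move=> irr; elim: p x => [|y p IH] x /=.
  move=> _; have -> : traces [:: x] = trace x.
    apply/seteqP; split => z; first by move=> [v]; rewrite inE => /eqP ->.
    by exists x; rewrite ?mem_head.
  exact: trace_connected.
move=> /andP[exy py]; rewrite tracesS.
apply: connectedU; [|exact: trace_connected|exact: IH].
have xy : x != y by apply: contraTneq exy => ->; rewrite irr.
have [s [t [s01 t01 st]]] := (rep.2 x y xy).2 exy.
exists (g x s); split; first by exists s.
by exists y; [rewrite mem_head | exists t].
Qed.

Definition apart (s s' : seq T) := forall u v, u \in s -> v \in s' -> u != v /\ ~~ e u v.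

Lemma apart_traces s s' : apart s s' -> traces s `&` traces s' = set0.
Proof.
move=> ap; apply/seteqP; split => // z [[u us [a a01 az]] [v vs [b b01 bz]]].
have [uv] := ap u v us vs; case/negP; apply/(rep.2 u v uv).
by exists a, b; split => //; rewrite az bz.
Qed.

Lemma apart_anchor s s' u v : apart s s' -> u \in s -> v \in s' -> anchor u != anchor v.
Proof.
move=> ap us vs; apply/eqP => auv.
have : (traces s `&` traces s') (anchor u, 0).
  by split; [exists u | exists v => //; rewrite auv] => //; exact: trace_anchor.
by rewrite apart_traces.
Qed.

Definition between (a b x : R) := (a < x < b) || (b < x < a).

(** If the anchors interleaved, the two connected unions of curves would meet by
    [connected_crossing], but they are disjoint. [no1] and [no2] treat the two choices of which walk
    holds the leftmost anchor. *)
Lemma apart_no_interleave x p y q u1 u2 v1 v2 : irreflexive e ->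
  path e x p -> path e y q -> apart (x :: p) (y :: q) ->
  u1 \in x :: p -> u2 \in x :: p -> v1 \in y :: q -> v2 \in y :: q ->
  between (anchor u1) (anchor u2) (anchor v1) = between (anchor u1) (anchor u2) (anchor v2).
Proof.
move=> irr px py ap.
have cx := traces_connected irr px; have cy := traces_connected irr py.
have dis := apart_traces ap.
have le0 z : traces (x :: p) z \/ traces (y :: q) z -> z.2 <= 0.
  by case=> -[v _]; exact: trace_le0.
have an s v : v \in s -> traces s (anchor v, 0) by move=> vs; exists v => //; exact: trace_anchor.
have no1 a c b d : a \in x :: p -> c \in x :: p -> b \in y :: q -> d \in y :: q ->
    anchor a < anchor b -> anchor b < anchor c -> anchor c < anchor d -> False.
  move=> ha hc hb hd ab bc cd.
  have := connected_crossing (@traces_compact (x :: p)) cx (@traces_compact (y :: q)) cy le0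
    (an _ _ ha) (an _ _ hc) (an _ _ hb) (an _ _ hd) ab bc cd.
  by rewrite dis => -[].
have no2 a c b d : a \in x :: p -> c \in x :: p -> b \in y :: q -> d \in y :: q ->
    anchor b < anchor a -> anchor a < anchor d -> anchor d < anchor c -> False.
  move=> ha hc hb hd ab bc cd.
  have le0' z : traces (y :: q) z \/ traces (x :: p) z -> z.2 <= 0 by rewrite or_comm; exact: le0.
  have := connected_crossing (@traces_compact (y :: q)) cy (@traces_compact (x :: p)) cx le0'
    (an _ _ hb) (an _ _ hd) (an _ _ ha) (an _ _ hc) ab bc cd.
  by rewrite setIC dis => -[].
move=> hu1 hu2 hv1 hv2.
have := apart_anchor ap hu1 hv1; have := apart_anchor ap hu1 hv2.
have := apart_anchor ap hu2 hv1; have := apart_anchor ap hu2 hv2.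
have := no1 _ _ _ _ hu1 hu2 hv1 hv2; have := no1 _ _ _ _ hu1 hu2 hv2 hv1.
have := no1 _ _ _ _ hu2 hu1 hv1 hv2; have := no1 _ _ _ _ hu2 hu1 hv2 hv1.
have := no2 _ _ _ _ hu1 hu2 hv1 hv2; have := no2 _ _ _ _ hu1 hu2 hv2 hv1.
have := no2 _ _ _ _ hu2 hu1 hv1 hv2; have := no2 _ _ _ _ hu2 hu1 hv2 hv1.
rewrite /between; move: (anchor u1) (anchor u2) (anchor v1) (anchor v2) => a c b d.
clear; case: (ltgtP a b) => //; case: (ltgtP a d) => //; case: (ltgtP c b) => //;
  case: (ltgtP c d) => // h1 h2 h3 h4 f1 f2 f3 f4 f5 f6 f7 f8 _ _ _ _;
  apply/eqP => //; exfalso; first [exact: f1|exact: f2|exact: f3|exact: f4|exact: f5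
   |exact: f6|exact: f7|exact: f8].
Qed.

Lemma no_three_arms (s t : T) (x : 'I_3 -> T) (p q : 'I_3 -> seq T) : irreflexive e ->
  (forall i, path e (x i) (p i) /\ last (x i) (p i) = t) ->
  (forall i, path e (x i) (q i) /\ last (x i) (q i) = s) ->
  (forall i j, i != j -> apart (x i :: p i) (x j :: q j)) -> False.
Proof.
move=> irr hp hq ap.
(* There are only two sides for three arms, while two arms on the same side would interleave. *)
pose side i := between (anchor s) (anchor t) (anchor (x i)).
have ne i j : i != j -> side i != side j.
  move=> ij; have ji : j != i by rewrite eq_sym.
  have [pi ti] := hp i; have [pj tj] := hp j.
  have [qi si] := hq i; have [qj sj] := hq j.
  have ti' : t \in x i :: p i by rewrite -ti mem_last.
  have tj' : t \in x j :: p j by rewrite -tj mem_last.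
  have si' : s \in x i :: q i by rewrite -si mem_last.
  have sj' : s \in x j :: q j by rewrite -sj mem_last.
  have hi (r : seq T) : x i \in x i :: r by rewrite mem_head.
  have hj (r : seq T) : x j \in x j :: r by rewrite mem_head.
  have := apart_no_interleave irr pi qj (ap _ _ ij) (hi _) ti' (hj _) sj'.
  have := apart_no_interleave irr pj qi (ap _ _ ji) (hj _) tj' (hi _) si'.
  have := apart_anchor (ap _ _ ij) (hi _) (hj _).
  have := apart_anchor (ap _ _ ij) (hi _) sj'.
  have := apart_anchor (ap _ _ ij) ti' (hj _).
  have := apart_anchor (ap _ _ ij) ti' sj'.
  have := apart_anchor (ap _ _ ji) (hj _) si'.
  have := apart_anchor (ap _ _ ji) tj' (hi _).
  rewrite /side /between; move: (anchor s) (anchor t) (anchor (x i)) (anchor (x j)).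
  clear => a b c d.
  case: (ltgtP b c) => //; case: (ltgtP a d) => //; case: (ltgtP a b) => //;
  case: (ltgtP b d) => //; case: (ltgtP a c) => //; case: (ltgtP c d) => //; try lra.
have := ne ord0 (inord 1); have := ne ord0 (inord 2); have := ne (inord 1) (inord 2).
rewrite -!val_eqE /= !inordK //= => /(_ isT) + /(_ isT) + /(_ isT).
by case: (side _); case: (side _); case: (side _).
Qed.

End GroundedWalks.

Local Close Scope ring_scope.
Local Close Scope classical_set_scope.

Theorem theorem3 (T : finType) (e : rel T) :
  symmetric e -> irreflexive e ->
  series_parallel e -> no_transitive_edges e ->
  (at_most_2_heavy e <-> outerstring Rdefinitions.R e) /\
  (outerstring Rdefinitions.R e <-> has_LGamma_mirror_rep Rdefinitions.R e).
Proof.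
move=> e_sym e_irr [bi noK4] nte.
have draw : at_most_2_heavy e -> has_LGamma_mirror_rep Rdefinitions.R e.
  move=> heavy2.
  have [ro [l [r [g [m [ok adj]]]]]] := exists_layout e_sym e_irr bi noK4 nte heavy2.
  exact: layout_LGamma ok adj.
have outer : has_LGamma_mirror_rep Rdefinitions.R e -> outerstring Rdefinitions.R e.
  by move=> [g [rep _]]; exists g.
have light : outerstring Rdefinitions.R e -> at_most_2_heavy e.
  move=> [g rep] s t [st _]; rewrite leqNgt; apply/negP => heavy3.
  have [x [p [q [hp hq ap]]]] := heavy_arms e_sym e_irr bi noK4 nte st heavy3.
  exact: (no_three_arms rep e_irr hp hq ap).
by split; [split => [/draw/outer|/light] | split => [/light/draw|/outer]].
Qed.
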